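(* Let $a,b\in L^\infty$ satisfy $a\neq 0$ a.e. on $\mathbb T$, $b\neq 0$ a.e. on $\mathbb T$, and either $a=b$ or $a-b\neq 0$ a.e. on $\mathbb T$. Let $h_-\in\overline{H^\infty}$. Then: (i) $\ker^+ S_{a,\,bh_-}\subseteq \ker^+ S_{a,b}\subseteq \ker^+ S_{ah_-,\,b}$; (ii) if $\overline{h_-}$ is outer, then $$\ker^+ S_{a,\,bh_-}=\ker^+ S_{a,b}\quad\text{if }\ \frac{a}{bh_-}\in L^\infty,$$ and $$\ker^+ S_{ah_-,\,b}=\ker^+ S_{a,b}=\ker T_{a/b}\quad\text{if }\ \frac ab\in L^\infty;$$ (iii) if $\overline{h_-}$ is not outer, then the inclusions in (i) are strict.
   Context: $\mathbb T$ is the unit circle, $\mathbb D$ the unit disc, $L^2=L^2(\mathbb T)$, $L^\infty=L^\infty(\mathbb T)$. $H^2_+=H^2(\mathbb D)$ is identified with a closed subspace of $L^2$ via boundary values, and $H^2_-=L^2\ominus H^2_+=\overline{H^2_0}$. $P^{\pm}$ are the orthogonal projections of $L^2$ onto $H^2_\pm$. $H^\infty$ is the algebra of bounded analytic functions on $\mathbb D$ (identified with boundary functions) and $\overline{H^\infty}$ the set of complex conjugates of its elements. For $a,b\in L^\infty$ the paired operator $S_{a,b}:L^2\to L^2$ is $S_{a,b}\phi=aP^+\phi+bP^-\phi$, and $\ker^{+}S_{a,b}:=P^{+}\ker S_{a,b}$, i.e. $\phi_+\in\ker^+S_{a,b}$ iff $\phi_+\in H^2_+$ and there is $\phi_-\in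 H^2_-$ with $a\phi_++b\phi_-=0$. For $g\in L^\infty$, $T_g:H^2_+\to H^2_+$, $T_g\phi=P^+(g\phi)$, is the Toeplitz operator.
   Formalization: In (iii) each inclusion is claimed strict only if its larger space is not {0}; as stated (iii) fails, e.g. for a = z, b = 1, h_- = conj(z), where all three kernels are {0}. ''Outer'' is taken in Beurling's sense (cyclic vector of the shift on H^2). *)

(* Defs.v *)
From HB Require Import structures.
From mathcomp Require Import all_boot all_order all_algebra.
From mathcomp Require Import all_classical all_reals all_analysis.
From mathcomp Require Import complex.
Set Implicit Arguments.
Unset Strict Implicit.
Unset Printing Implicit Defensive.
Import Order.TTheory GRing.Theory Num.Theory.
Import numFieldNormedType.Exports.
Local Open Scope classical_set_scope.
Local Open Scope ring_scope.
Local Open Scope complex_scope.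
Import ComplexField.Normc.

(* A function on the unit circle is given by the angle t in [0, 2 pi], i.e. by
   f : R -> R[i] with f t its value at e^{it}, almost everywhere for the
   normalised arc length [circle]. Elements of L^p are represented by such
   functions, so "equal" always means equal [circle]-almost everywhere, and the
   subspaces below are sets of representatives closed under that relation
   (among Borel functions). *)

Lemma two_pi_gt0 (R : realType) : 0 < 2 * pi :> R.
Proof. by rewrite mulr_gt0// pi_gt0. Qed.

Definition circle (R : realType) : probability (measurableTypeR R) R :=
  uniform_prob (@two_pi_gt0 R).

Section PairedOperators.
Context {R : realType}.
Local Notation m := (circle R).
Local Notation fct := (R -> R[i]).

Definition eit (t : R) : R[i] := cos t +i* sin t.

Definition Lp (p : \bar R) : set fct :=
  [set f | (fun t => complex.Re (f t)) \in Lfun m p /\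
           (fun t => complex.Im (f t)) \in Lfun m p].

Definition L2 : set fct := Lp 2%:E.
Definition Linfty : set fct := Lp +oo%E.

Definition L2dist (f g : fct) : \bar R :=
  Lnorm m 2%:E (fun t => (normc (f t - g t))%:E).

Definition inner (f g : fct) : R[i] :=
  (\int[m]_t (complex.Re (f t * conjc (g t)))) +i*
  (\int[m]_t (complex.Im (f t * conjc (g t)))).

Definition disc_series (c : nat -> R[i]) (F : R[i] -> R[i]) :=
  forall z, normc z < 1 ->
    normc (F z - \sum_(k < n) c k * z ^+ k) @[n --> \oo] --> (0 : R).

Definition H2_disc : set (R[i] -> R[i]) :=
  [set F | exists c, disc_series c F /\
                     cvgn (series (fun n => normc (c n) ^+ 2 : R))].

Definition Hinfty_disc : set (R[i] -> R[i]) :=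
  [set F | (exists c, disc_series c F) /\
           exists M : R, forall z, normc z < 1 -> normc (F z) <= M].

(* f is the L^2 limit of the dilates F_r(e^{it}) = F(r e^{it}) as r -> 1^-; for
   F in H^2(D) this is the a.e. nontangential boundary function of F. *)
Definition boundary (F : R[i] -> R[i]) (f : fct) :=
  L2dist (fun t => F (r%:C * eit t)) f @[r --> (1 : R)^'-] --> 0%E.

Definition H2plus : set fct :=
  [set f | L2 f /\ exists2 F, H2_disc F & boundary F f].

Definition H2minus : set fct :=
  [set f | L2 f /\ forall g, H2plus g -> inner f g = 0].

Definition Hinfty : set fct :=
  [set f | Linfty f /\ exists2 F, Hinfty_disc F & boundary F f].

(* Orthogonal projection onto a closed subspace V, with a chosen representative
   of the value. *)
Definition proj (V : set fct) (f : fct) : fct :=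
  xget (cst 0) [set g | V g /\ forall h, V h -> inner (f \- g) h = 0].

Definition Pplus : fct -> fct := proj H2plus.
Definition Pminus : fct -> fct := proj H2minus.

Definition paired (a b f : fct) : fct := (a \* Pplus f) \+ (b \* Pminus f).

Definition ker_paired (a b : fct) : set fct :=
  [set f | L2 f /\ paired a b f = cst 0 %[ae m]].

(* P^+ (ker S_{a,b}), including all representatives of each element *)
Definition kerplus (a b : fct) : set fct :=
  [set g | L2 g /\ exists2 f, ker_paired a b f & g = Pplus f %[ae m]].

Definition toeplitz (g f : fct) : fct := Pplus (g \* f).

Definition ker_toeplitz (g : fct) : set fct :=
  [set f | H2plus f /\ toeplitz g f = cst 0 %[ae m]].

(* Outer functions in Beurling's sense: cyclic vectors of multiplication by the
   variable on H^2, i.e. the polynomial multiples of f are dense in H^2. *)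
Definition outer (f : fct) :=
  H2plus f /\
  forall g, H2plus g -> forall e : R, 0 < e ->
    exists p : {poly R[i]}, (L2dist (fun t => p.[eit t] * f t)%R g < e%:E)%E.

(* V is not the zero subspace of L^2; an inclusion into the zero subspace is
   never strict. *)
Definition nontrivial (V : set fct) :=
  exists2 f, V f & ~ (f = cst 0 %[ae m]).

Definition fdiv (f g : fct) : fct := fun t => f t / g t.
Definition fconj (f : fct) : fct := fun t => conjc (f t).

End PairedOperators.

(* Main.v *)
Require Import Defs.
From HB Require Import structures.
From mathcomp Require Import all_boot all_order all_algebra.
From mathcomp Require Import all_classical all_reals all_analysis.
From mathcomp Require Import measurable_realfun ess_sup_inf complex.
From mathcomp Require Import ring lra.
Set Implicit Arguments.
Unset Strict Implicit.
Unset Printing Implicit Defensive.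
Import Order.TTheory GRing.Theory Num.Theory.
Import numFieldNormedType.Exports.
Import ComplexField.Normc.
Local Open Scope classical_set_scope.
Local Open Scope ring_scope.
Local Open Scope complex_scope.

(* With H^2_+ and H^2_- described by vanishing Fourier coefficients, phi_+ lies
   in ker^+ S_(a,b) iff a phi_+ + b phi_- = 0 for some phi_- in H^2_-, and the
   inclusions hold because h H^2_- is contained in H^2_-. If conj h is outer and
   psi is in L^2 with h psi in H^2_-, then psi is in H^2_-, since psi is
   orthogonal to the polynomial multiples of conj h, which are dense.
   If conj h is not outer, then conj h = I g with I a nonconstant inner
   function. If one of the inclusions were an equality, ker^+ S_(a,b) would be
   stable under multiplication by I, so that I^n phi_- would lie in H^2_- for
   all n; since |I(0)| < 1 this forces phi_- = 0, hence phi_+ = 0. *)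

(** * Complex-valued integration on the circle *)

(** The spaces [H2plus] and [Hinfty] are defined by boundary values of functions on the disc,
    whereas the kernels are handled through Fourier coefficients only. The bridge is [H2plusP]; it
    rests on the density of polynomials, hence on the completeness of L2 and on the uniqueness of
    Fourier coefficients. In the factorisation conj h = I g it is enough that g be bounded and
    analytic. Outerness means cyclicity here, so Beurling's construction gives such a factorisation
    directly, and a constant I would make conj h cyclic. Stability under I comes from the identity I
    h = conj g, valid on the circle because |I| = 1: multiplying a phi_+ + b h phi_- = 0 by I gives
    a (I phi_+) + b (conj g phi_-) = 0, and conj g phi_- is again in H^2_-. Thus I trades the factor
    h for conj g, and an equality of kernels restores h. *)

Section ComplexNumbers.
Context {R : realType}.
Implicit Types x y : R[i].
Local Notation Re := (@complex.Re R).
Local Notation Im := (@complex.Im R).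

Lemma normc2E x : normc x ^+ 2 = Re x ^+ 2 + Im x ^+ 2.
Proof. by case: x => a b /=; rewrite sqr_sqrtr ?addr_ge0 ?sqr_ge0. Qed.

Lemma normc_ge0 x : 0 <= normc x.
Proof. by case: x => a b /=; rewrite sqrtr_ge0. Qed.

Lemma normc_conj x : normc (conjc x) = normc x.
Proof. by case: x => a b /=; rewrite sqrrN. Qed.

Lemma normcD x y : normc (x + y) <= normc x + normc y.
Proof.
have nE (u : R[i]) : `|u| = (normc u)%:C by case: u.
by have := ler_normD x y; rewrite !nE -rmorphD/= lecR.
Qed.

Lemma normcN x : normc (- x) = normc x.
Proof. by case: x => a b /=; rewrite !sqrrN. Qed.

Lemma normc_real (r : R) : normc r%:C = `|r|.
Proof. by rewrite /= expr0n addr0 sqrtr_sqr. Qed.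

Lemma normcX x n : normc (x ^+ n) = normc x ^+ n.
Proof.
elim: n => [|n ih]; first by rewrite !expr0 normc1.
by rewrite !exprS normcM ih.
Qed.

Lemma cReD x y : Re (x + y) = Re x + Re y. Proof. by case: x; case: y. Qed.
Lemma cImD x y : Im (x + y) = Im x + Im y. Proof. by case: x; case: y. Qed.
Lemma cReN x : Re (- x) = - Re x. Proof. by case: x. Qed.
Lemma cImN x : Im (- x) = - Im x. Proof. by case: x. Qed.
Lemma cReM x y : Re (x * y) = Re x * Re y - Im x * Im y.
Proof. by case: x; case: y. Qed.
Lemma cImM x y : Im (x * y) = Re x * Im y + Im x * Re y.
Proof. by case: x; case: y. Qed.
Lemma cReJ x : Re (conjc x) = Re x. Proof. by case: x. Qed.
Lemma cImJ x : Im (conjc x) = - Im x. Proof. by case: x. Qed.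

Definition ReImE := (cReD, cImD, cReN, cImN, cReM, cImM, cReJ, cImJ).

Lemma complexP x y : Re x = Re y -> Im x = Im y -> x = y.
Proof. by case: x => a b; case: y => c d /= -> ->. Qed.

Lemma normc_Re x : `|Re x| <= normc x.
Proof.
by rewrite -[normc x]ger0_norm ?normc_ge0// -ler_sqr ?nnegrE// !real_normK ?num_real//
  normc2E lerDl sqr_ge0.
Qed.

Lemma normc_Im x : `|Im x| <= normc x.
Proof.
by rewrite -[normc x]ger0_norm ?normc_ge0// -ler_sqr ?nnegrE// !real_normK ?num_real//
  normc2E lerDr sqr_ge0.
Qed.

Lemma normc_le_ReIm x : normc x <= `|Re x| + `|Im x|.
Proof.
rewrite -ler_sqr ?nnegrE ?normc_ge0 ?addr_ge0// normc2E sqrrD !real_normK ?num_real//.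
by rewrite lerD2r lerDl mulrn_wge0// mulr_ge0.
Qed.

Lemma normcD2 x y :
  normc (x + y) ^+ 2 = normc x ^+ 2 + normc y ^+ 2 + 2 * Re (x * conjc y).
Proof. by rewrite !normc2E !ReImE; ring. Qed.

Lemma mulc_conj x : x * conjc x = (normc x ^+ 2)%:C.
Proof. by rewrite normc2E; apply: complexP; rewrite !ReImE/=; ring. Qed.

Lemma normc_eq0 x : (normc x == 0) = (x == 0).
Proof.
apply/eqP/eqP => [/eq0_normc//|->]; exact: normc0.
Qed.

End ComplexNumbers.

(** * Almost-everywhere statements and componentwise integrals *)

Section CircleIntegration.
Context {R : realType}.
Local Notation m := (circle R).
Local Notation fct := (R -> R[i]).
Local Notation Re := (@complex.Re R).
Local Notation Im := (@complex.Im R).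
Implicit Types f g : fct.

(* Filter instances are not inferred for [circle R], whose carrier is
   [measurableTypeR R] and not [R]. *)
Lemma aeS (P Q : R -> Prop) : (forall t, P t -> Q t) ->
  {ae m, forall t, P t} -> {ae m, forall t, Q t}.
Proof.
by move=> PQ; apply: (@filterS _ _ (@ae_filter_ringOfSetsType _ (measurableTypeR R) R m)).
Qed.

Lemma aeS2 (P Q S : R -> Prop) : (forall t, P t -> Q t -> S t) ->
  {ae m, forall t, P t} -> {ae m, forall t, Q t} -> {ae m, forall t, S t}.
Proof.
by move=> PQ; apply: (@filterS2 _ _ (@ae_filter_ringOfSetsType _ (measurableTypeR R) R m)).
Qed.

Lemma ae_and (P Q : R -> Prop) : {ae m, forall t, P t} ->
  {ae m, forall t, Q t} -> {ae m, forall t, P t /\ Q t}.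
Proof. exact: aeS2 (fun t => @conj _ _). Qed.

Lemma aeW (P : R -> Prop) : (forall t, P t) -> {ae m, forall t, P t}.
Proof.
by move=> p; apply: (@nearW _ _ _ (@ae_filter_ringOfSetsType _ (measurableTypeR R) R m)).
Qed.

Lemma aeqP (T : Type) (f g : R -> T) :
  f = g %[ae m] <-> {ae m, forall t, f t = g t}.
Proof. by split; apply: aeS => t; [apply|]. Qed.

Definition cmeas f :=
  measurable_fun [set: measurableTypeR R] (fun t => Re (f t)) /\
  measurable_fun [set: measurableTypeR R] (fun t => Im (f t)).

Lemma cmeasD f g : cmeas f -> cmeas g -> cmeas (fun t => f t + g t).
Proof.
move=> [f1 f2] [g1 g2]; split.
  by under eq_fun do rewrite cReD; exact: measurable_funD.
by under eq_fun do rewrite cImD; exact: measurable_funD.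
Qed.

Lemma cmeasN f : cmeas f -> cmeas (fun t => - f t).
Proof.
move=> [f1 f2]; split.
  by under eq_fun do rewrite cReN; exact: measurable_funN.
by under eq_fun do rewrite cImN; exact: measurable_funN.
Qed.

Lemma cmeasM f g : cmeas f -> cmeas g -> cmeas (fun t => f t * g t).
Proof.
move=> [f1 f2] [g1 g2]; split.
  by under eq_fun do rewrite cReM; apply: measurable_funB; exact: measurable_funM.
by under eq_fun do rewrite cImM; apply: measurable_funD; exact: measurable_funM.
Qed.

Lemma cmeas_conj f : cmeas f -> cmeas (fun t => conjc (f t)).
Proof.
move=> [f1 f2]; split.
  by under eq_fun do rewrite cReJ.
by under eq_fun do rewrite cImJ; exact: measurable_funN.
Qed.

Lemma cmeas_cst (c : R[i]) : cmeas (fun=> c).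
Proof. by split; exact: measurable_cst. Qed.

Lemma cmeas_real (u : R -> R) :
  measurable_fun [set: measurableTypeR R] u -> cmeas (fun t => (u t)%:C).
Proof. by move=> mu; split => //=; exact: measurable_cst. Qed.

Lemma cmeasX f n : cmeas f -> cmeas (fun t => f t ^+ n).
Proof.
move=> mf; elim: n => [|n ih]; first exact: cmeas_cst.
by under eq_fun do rewrite exprS; exact: cmeasM.
Qed.

Lemma cmeas_eit : cmeas eit.
Proof.
split; first exact: (continuous_measurable_fun (@continuous_cos R)).
exact: (continuous_measurable_fun (@continuous_sin R)).
Qed.

Lemma measurable_normc2 f : cmeas f ->
  measurable_fun [set: measurableTypeR R] (fun t => normc (f t) ^+ 2).
Proof.
move=> [f1 f2]; under eq_fun do rewrite normc2E.
by apply: measurable_funD; exact: measurable_funX.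
Qed.

Lemma measurable_normc f : cmeas f ->
  measurable_fun [set: measurableTypeR R] (fun t => normc (f t)).
Proof.
move=> mf; under eq_fun do rewrite -[normc _]ger0_norm ?normc_ge0// -sqrtr_sqr.
apply: (@measurableT_comp _ _ _ _ _ _ (@Num.sqrt R)).
  exact: (continuous_measurable_fun (@sqrt_continuous R)).
exact: measurable_normc2.
Qed.

Definition rintegrable (u : R -> R) := m.-integrable setT (EFin \o u).
Definition cintegrable f := rintegrable (fun t => Re (f t)) /\ rintegrable (fun t => Im (f t)).
Definition cint f : R[i] := (\int[m]_t Re (f t)) +i* (\int[m]_t Im (f t)).

Lemma rintegrable_measurable (u : R -> R) : rintegrable u ->
  measurable_fun [set: measurableTypeR R] u.
Proof. by move=> /measurable_int/measurable_EFinP. Qed.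

Lemma rintegrable_le (u v : R -> R) : measurable_fun [set: measurableTypeR R] u ->
  (forall t, `|u t| <= v t) -> rintegrable v -> rintegrable u.
Proof.
move=> mu uv iv; apply: (le_integrable measurableT _ _ iv).
  exact/measurable_EFinP.
move=> t _ /=; rewrite lee_fin (le_trans (uv t))// ler_norm//.
Qed.

Lemma rintegrableD u v : rintegrable u -> rintegrable v -> rintegrable (fun t => u t + v t).
Proof.
move=> iu iv; rewrite /rintegrable.
rewrite (_ : _ \o _ = ((EFin \o u) \+ (EFin \o v))%E)//.
exact: integrableD.
Qed.

Lemma rintegrableZ (k : R) u : rintegrable u -> rintegrable (fun t => k * u t).
Proof.
move=> iu; rewrite /rintegrable.
rewrite (_ : _ \o _ = (fun t => k%:E * (EFin \o u) t)%E)//.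
exact: integrableZl.
Qed.

Lemma rintegrableN u : rintegrable u -> rintegrable (fun t => - u t).
Proof. by move=> iu; under eq_fun do rewrite -mulN1r; exact: rintegrableZ. Qed.

Lemma rintegrable_cst (k : R) : rintegrable (fun=> k).
Proof. exact: finite_measure_integrable_cst. Qed.

Lemma rintegrable_norm u : rintegrable u -> rintegrable (fun t => `|u t|).
Proof. exact: integrable_norm. Qed.

Lemma rintegrable_ae u v : measurable_fun [set: measurableTypeR R] v ->
  {ae m, forall t, u t = v t} -> rintegrable u -> rintegrable v.
Proof.
move=> mv uv iu; apply/integrableP; split; first exact/measurable_EFinP.
move/integrableP: (iu) => [_]; rewrite (@ge0_ae_eq_integral _ _ _ m setT
  (fun x => `|(EFin \o u) x|)%E (fun x => `|(EFin \o v) x|)%E)//.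
- by apply: measurableT_comp => //; exact: measurable_int iu.
- by apply: measurableT_comp => //; exact/measurable_EFinP.
- by apply: aeS uv => t /= uv _; rewrite uv.
Qed.

Lemma eq_ae_Rintegral (u v : R -> R) : measurable_fun [set: measurableTypeR R] u ->
  measurable_fun [set: measurableTypeR R] v ->
  {ae m, forall t, u t = v t} -> \int[m]_t u t = \int[m]_t v t.
Proof.
move=> mu mv uv; congr fine; apply: ae_eq_integral => //.
- exact/measurable_EFinP.
- exact/measurable_EFinP.
- by apply: aeS uv => t /= uv _; rewrite uv.
Qed.

(** The circle has mass 1, so the empty set is not of full measure. *)
Lemma ae_const (P : Prop) : {ae m, forall t : R, P} -> P.
Proof.
move=> h; apply: contrapT => nP.
have : \int[m]_t (1 : R) = \int[m]_t (0 : R).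
  by apply: eq_ae_Rintegral => //; apply: aeS h => t /nP.
by rewrite !Rintegral_cst//= probability_setT !mulr1 => /eqP; rewrite oner_eq0.
Qed.

Lemma cintegrable_cmeas f : cintegrable f -> cmeas f.
Proof. by move=> [? ?]; split; exact: rintegrable_measurable. Qed.

Lemma cintegrable_normc f : cmeas f -> rintegrable (fun t => normc (f t)) ->
  cintegrable f.
Proof.
move=> [f1 f2] fi; split; apply: rintegrable_le fi => // t.
  exact: normc_Re.
exact: normc_Im.
Qed.

Lemma normc_cintegrable f : cintegrable f -> rintegrable (fun t => normc (f t)).
Proof.
move=> fi; have [f1 f2] := fi.
apply: (@rintegrable_le _ (fun t => `|Re (f t)| + `|Im (f t)|)).
- by apply: measurable_normc; exact: cintegrable_cmeas.
- by move=> t; rewrite ger0_norm ?normc_ge0// normc_le_ReIm.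
- by apply: rintegrableD; exact: rintegrable_norm.
Qed.

Lemma cintegrable_le f (u : R -> R) : cmeas f ->
  (forall t, normc (f t) <= u t) -> rintegrable u -> cintegrable f.
Proof.
move=> mf fu iu; apply: cintegrable_normc => //.
apply: rintegrable_le iu; first exact: measurable_normc.
by move=> t; rewrite ger0_norm ?normc_ge0.
Qed.

Lemma cintegrableD f g : cintegrable f -> cintegrable g ->
  cintegrable (fun t => f t + g t).
Proof.
move=> [f1 f2] [g1 g2]; split.
  by under eq_fun do rewrite cReD; exact: rintegrableD.
by under eq_fun do rewrite cImD; exact: rintegrableD.
Qed.

Lemma cintegrableZ c f : cintegrable f -> cintegrable (fun t => c * f t).
Proof.
move=> [f1 f2]; split.
  under eq_fun do rewrite cReM.
  by apply: rintegrableD; [exact: rintegrableZ|apply: rintegrableN; exact: rintegrableZ].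
by under eq_fun do rewrite cImM; apply: rintegrableD; exact: rintegrableZ.
Qed.

Lemma cintegrable_opp f : cintegrable f -> cintegrable (fun t => - f t).
Proof. by move=> fi; under eq_fun do rewrite -mulN1r; exact: cintegrableZ. Qed.

Lemma cintD f g : cintegrable f -> cintegrable g ->
  cint (fun t => f t + g t) = cint f + cint g.
Proof.
move=> [f1 f2] [g1 g2]; apply: complexP; rewrite !ReImE/=.
  by under eq_Rintegral do rewrite cReD; rewrite RintegralD.
by under eq_Rintegral do rewrite cImD; rewrite RintegralD.
Qed.

Lemma cintZ c f : cintegrable f -> cint (fun t => c * f t) = c * cint f.
Proof.
move=> [f1 f2]; apply: complexP; rewrite !ReImE/=.
  under eq_Rintegral do rewrite cReM.
  by rewrite RintegralB ?RintegralZl//; exact: rintegrableZ.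
under eq_Rintegral do rewrite cImM.
by rewrite RintegralD ?RintegralZl//; exact: rintegrableZ.
Qed.

Lemma cintN f : cintegrable f -> cint (fun t => - f t) = - cint f.
Proof.
by move=> fi; under eq_fun do rewrite -mulN1r; rewrite cintZ// mulN1r.
Qed.

Lemma cint_conj f : cintegrable f ->
  cint (fun t => conjc (f t)) = conjc (cint f).
Proof.
move=> [f1 f2]; apply: complexP; rewrite !ReImE/=.
  by under eq_Rintegral do rewrite cReJ.
under eq_Rintegral do rewrite cImJ -mulN1r.
by rewrite RintegralZl// mulN1r.
Qed.

Lemma cint_ae f g : cmeas f -> cmeas g -> {ae m, forall t, f t = g t} ->
  cint f = cint g.
Proof.
move=> [f1 f2] [g1 g2] fg; congr (_ +i* _); apply: eq_ae_Rintegral => //.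
  by apply: aeS fg => t h; rewrite h.
by apply: aeS fg => t h; rewrite h.
Qed.

Lemma cint0 : cint (fun=> 0) = 0.
Proof. by rewrite /cint/= !Rintegral_cst//= mul0r. Qed.

Lemma cint_cst c : cint (fun=> c) = c.
Proof.
apply: complexP; rewrite /= Rintegral_cst//=;
by rewrite (_ : fine _ = 1) ?mulr1// -[RHS]/(fine 1%E) -(@probability_setT _ _ _ m).
Qed.

End CircleIntegration.

(** * The space L2 *)

Section L2Space.
Context {R : realType}.
Local Notation m := (circle R).
Local Notation fct := (R -> R[i]).
Local Notation Re := (@complex.Re R).
Local Notation Im := (@complex.Im R).
Implicit Types f g : fct.

Lemma Lfun2P (u : R -> R) : (u : measurableTypeR R -> R) \in Lfun m 2%:E <->
  measurable_fun [set: measurableTypeR R] u /\ rintegrable (fun t => u t ^+ 2).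
Proof.
split=> [h|[mu iu]].
  split; last exact: Lfun2_integrable_sqr.
  by move: h; rewrite inE => /andP[/[!inE]].
rewrite inE; apply/andP; split; first by rewrite inE.
rewrite inE/= /finite_norm unlock /= poweR_lty//.
under eq_integral do rewrite /= powR_mulrn//= real_normK ?num_real//.
exact: integrable_lty iu.
Qed.

Lemma L2P f : L2 f <-> cmeas f /\ rintegrable (fun t => normc (f t) ^+ 2).
Proof.
rewrite /L2 /Lp/=; split.
  move=> [/Lfun2P[m1 i1] /Lfun2P[m2 i2]]; split => //.
  by under eq_fun do rewrite normc2E; exact: rintegrableD.
move=> [[m1 m2] i]; split; apply/Lfun2P; split=> //.
- apply: rintegrable_le i; first exact: measurable_funX.
  by move=> t; rewrite normc2E ger0_norm ?sqr_ge0// lerDl sqr_ge0.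
- apply: rintegrable_le i; first exact: measurable_funX.
  by move=> t; rewrite normc2E ger0_norm ?sqr_ge0// lerDr sqr_ge0.
Qed.

Lemma LfunyP (u : R -> R) : (u : measurableTypeR R -> R) \in Lfun m +oo%E <->
  measurable_fun [set: measurableTypeR R] u /\
  exists M, {ae m, forall t, `|u t| <= M}.
Proof.
have m0 : (0 < m setT)%E by rewrite probability_setT.
split=> [h|[mu [M uM]]].
  move: h; rewrite inE => /andP[/[!inE]/= mu].
  rewrite /finite_norm unlock /= m0 => h; split=> //.
  by have [M hM] := ess_supr_bounded h; exists M.
rewrite inE; apply/andP; split; first by rewrite inE.
rewrite inE/= /finite_norm unlock /= m0.
apply: (@le_lt_trans _ _ M%:E); last exact: ltry.
by apply/ess_supP; apply: aeS uM => t/=; rewrite lee_fin.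
Qed.

Lemma LinftyP f : Linfty f <->
  cmeas f /\ exists M, {ae m, forall t, normc (f t) <= M}.
Proof.
rewrite /Linfty /Lp/=; split.
  move=> [/LfunyP[m1 [M1 h1]] /LfunyP[m2 [M2 h2]]]; split => //.
  exists (M1 + M2); apply: aeS2 h1 h2 => t h1 h2.
  by rewrite (le_trans (normc_le_ReIm _))// lerD.
move=> [[m1 m2] [M h]]; split; apply/LfunyP; split=> //; exists M;
  apply: aeS h => t; apply: le_trans; [exact: normc_Re|exact: normc_Im].
Qed.

Lemma L2_cmeas f : L2 f -> cmeas f. Proof. by move=> /L2P[]. Qed.

Lemma L2_integrable_normc2 f : L2 f -> rintegrable (fun t => normc (f t) ^+ 2).
Proof. by move=> /L2P[]. Qed.

Lemma normcD2_le (x y : R[i]) :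
  normc (x + y) ^+ 2 <= 2 * normc x ^+ 2 + 2 * normc y ^+ 2.
Proof.
rewrite !normc2E !ReImE.
have := sqr_ge0 (Re x - Re y); have := sqr_ge0 (Im x - Im y); nra.
Qed.

Lemma L2D f g : L2 f -> L2 g -> L2 (fun t => f t + g t).
Proof.
move=> /L2P[mf f2] /L2P[mg g2]; apply/L2P; split; first exact: cmeasD.
apply: (@rintegrable_le _ _ (fun t => 2 * normc (f t) ^+ 2 + 2 * normc (g t) ^+ 2)).
- by apply: measurable_normc2; exact: cmeasD.
- by move=> t; rewrite ger0_norm ?sqr_ge0// normcD2_le.
- by apply: rintegrableD; exact: rintegrableZ.
Qed.

Lemma L2_ae f g : cmeas g -> {ae m, forall t, f t = g t} -> L2 f -> L2 g.
Proof.
move=> mg fg /L2P[mf f2]; apply/L2P; split => //.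
apply: rintegrable_ae f2; first exact: measurable_normc2.
by apply: aeS fg => t ->.
Qed.

Lemma L2_le f (u : R -> R) : cmeas f ->
  {ae m, forall t, normc (f t) ^+ 2 <= u t} -> rintegrable u -> L2 f.
Proof.
move=> mf fu iu; apply/L2P; split=> //.
apply/integrableP; split; first by apply/measurable_EFinP; exact: measurable_normc2.
move/integrableP: (iu) => [_]; apply: le_lt_trans.
apply: ae_ge0_le_integral => //.
- by apply: measurableT_comp => //; apply/measurable_EFinP; exact: measurable_normc2.
- by apply: measurableT_comp => //; apply/measurable_EFinP; exact: rintegrable_measurable.
- apply: aeS fu => t ft _; rewrite /= lee_fin ger0_norm ?sqr_ge0//.
  by rewrite (le_trans ft)// ler_norm.
Qed.

Lemma Linfty_L2 f : Linfty f -> L2 f.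
Proof.
move=> /LinftyP[mf [M fM]]; apply: (L2_le (u := fun=> M ^+ 2)) => //.
  apply: aeS fM => t ft; rewrite ler_sqr ?nnegrE ?normc_ge0//.
  by rewrite (le_trans _ ft)// normc_ge0.
exact: rintegrable_cst.
Qed.

Lemma LinftyM f g : Linfty f -> L2 g -> L2 (fun t => f t * g t).
Proof.
move=> /LinftyP[mf [M fM]] /L2P[mg g2].
apply: (L2_le (u := fun t => M ^+ 2 * normc (g t) ^+ 2)).
- exact: cmeasM.
- apply: aeS fM => t ft; rewrite normcM exprMn ler_wpM2r ?sqr_ge0//.
  by rewrite ler_sqr ?nnegrE ?normc_ge0// (le_trans _ ft)// normc_ge0.
- exact: rintegrableZ.
Qed.

Lemma Linfty_cst c : Linfty (fun=> c : R[i]).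
Proof.
apply/LinftyP; split; first exact: cmeas_cst.
by exists (normc c); apply: aeW.
Qed.

Lemma Linfty_mul f g : Linfty f -> Linfty g -> Linfty (fun t => f t * g t).
Proof.
move=> /LinftyP[mf [M fM]] /LinftyP[mg [K gK]]; apply/LinftyP.
split; first exact: cmeasM.
exists (M * K); apply: aeS2 fM gK => t fM gK.
by rewrite normcM ler_pM ?normc_ge0.
Qed.

Lemma L2Z c f : L2 f -> L2 (fun t => c * f t).
Proof. by move=> f2; apply: (@LinftyM (fun=> c)) => //; exact: Linfty_cst. Qed.

Lemma L2N f : L2 f -> L2 (fun t => - f t).
Proof. by move=> f2; under eq_fun do rewrite -mulN1r; exact: L2Z. Qed.

Lemma L2B f g : L2 f -> L2 g -> L2 (fun t => f t - g t).
Proof. by move=> f2 g2; apply: L2D => //; exact: L2N. Qed.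

Lemma L2_cst c : L2 (fun=> c : R[i]).
Proof. by apply: Linfty_L2; exact: Linfty_cst. Qed.

Lemma L2_conj f : L2 f -> L2 (fun t => conjc (f t)).
Proof.
move=> /L2P[mf f2]; apply/L2P; split; first exact: cmeas_conj.
by under eq_fun do rewrite normc_conj.
Qed.

Lemma Linfty_conj f : Linfty f -> Linfty (fun t => conjc (f t)).
Proof.
move=> /LinftyP[mf [M h]]; apply/LinftyP; split; first exact: cmeas_conj.
by exists M; apply: aeS h => t; rewrite normc_conj.
Qed.

Lemma L2_cintegrable f g : L2 f -> L2 g -> cintegrable (fun t => f t * g t).
Proof.
move=> /L2P[mf f2] /L2P[mg g2].
apply: (@cintegrable_le _ _ (fun t => normc (f t) ^+ 2 + normc (g t) ^+ 2)).
- exact: cmeasM.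
- move=> t; rewrite normcM.
  have := sqr_ge0 (normc (f t) - normc (g t)).
  have := mulr_ge0 (normc_ge0 (f t)) (normc_ge0 (g t)); nra.
- exact: rintegrableD.
Qed.

Lemma L2_cintegrable1 f : L2 f -> cintegrable f.
Proof.
move=> f2; have := L2_cintegrable f2 (L2_cst 1).
by under eq_fun do rewrite mulr1.
Qed.

Definition sqnorm f : R := \int[m]_t normc (f t) ^+ 2.

Lemma sqnorm_ge0 f : 0 <= sqnorm f.
Proof. by apply: Rintegral_ge0 => t _; exact: sqr_ge0. Qed.

Lemma sqnorm_ae f g : cmeas f -> cmeas g -> {ae m, forall t, f t = g t} -> sqnorm f = sqnorm g.
Proof.
move=> mf mg fg; apply: eq_ae_Rintegral; [exact: measurable_normc2..|].
by apply: aeS fg => t ->.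
Qed.

Lemma sqnorm_eq0 f : L2 f -> sqnorm f = 0 -> {ae m, forall t, f t = 0}.
Proof.
move=> /L2P[mf f2] Nf0.
have mf2 : measurable_fun [set: measurableTypeR R]
    (fun t => (normc (f t) ^+ 2)%:E).
  by apply/measurable_EFinP; exact: measurable_normc2.
have := (ae_eq_integral_abs m measurableT mf2).1.
have -> : (\int[m]_x `|(normc (f x) ^+ 2)%:E|)%E = (sqnorm f)%:E.
  rewrite /sqnorm /Rintegral fineK ?integrable_fin_num//.
  by apply: eq_integral => t _; rewrite gee0_abs ?lee_fin ?sqr_ge0.
rewrite Nf0 => /(_ erefl); apply: aeS => t /(_ I) [] /eqP.
by rewrite sqrf_eq0 normc_eq0 => /eqP.
Qed.

Lemma sqnormD f g : L2 f -> L2 g ->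
  sqnorm (fun t => f t + g t) =
  sqnorm f + sqnorm g + 2 * Re (cint (fun t => f t * conjc (g t))).
Proof.
move=> f2 g2; rewrite /sqnorm /=.
have [ifg _] := L2_cintegrable f2 (L2_conj g2).
have [/L2_integrable_normc2 f2' /L2_integrable_normc2 g2'] := (f2, g2).
under eq_Rintegral do rewrite normcD2.
by rewrite !RintegralD ?RintegralZl//; [exact: rintegrableD|exact: rintegrableZ].
Qed.

Lemma sqnormZ c f : L2 f -> sqnorm (fun t => c * f t) = normc c ^+ 2 * sqnorm f.
Proof.
move=> /L2_integrable_normc2 f2; rewrite /sqnorm.
under eq_Rintegral do rewrite normcM exprMn.
by rewrite RintegralZl.
Qed.

Lemma sqnormN f : sqnorm (fun t => - f t) = sqnorm f.
Proof. by rewrite /sqnorm; under eq_Rintegral do rewrite normcN. Qed.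

Lemma sqnorm_conj f : sqnorm (fun t => conjc (f t)) = sqnorm f.
Proof. by rewrite /sqnorm; under eq_Rintegral do rewrite normc_conj. Qed.

Lemma sqnormD_le f g : L2 f -> L2 g ->
  sqnorm (fun t => f t + g t) <= 2 * sqnorm f + 2 * sqnorm g.
Proof.
move=> f2 g2; have fg2 := L2D f2 g2.
have [/L2_integrable_normc2 f2' /L2_integrable_normc2 g2' /L2_integrable_normc2 fg2'] :=
  And3 f2 g2 fg2.
rewrite /sqnorm -!RintegralZl// -RintegralD//; try exact: rintegrableZ.
apply: le_Rintegral => //; first by apply: rintegrableD; exact: rintegrableZ.
by move=> t _; exact: normcD2_le.
Qed.

Lemma parallelogram f g : L2 f -> L2 g ->
  sqnorm (fun t => f t + g t) + sqnorm (fun t => f t - g t) = 2 * sqnorm f + 2 * sqnorm g.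
Proof.
move=> f2 g2; have [/L2_integrable_normc2 f2' /L2_integrable_normc2 g2'] := (f2, g2).
have [/L2_integrable_normc2 a2 /L2_integrable_normc2 b2] := (L2D f2 g2, L2B f2 g2).
rewrite /sqnorm -!RintegralZl// -!RintegralD//; try exact: rintegrableZ.
by apply: eq_Rintegral => t _; rewrite !normc2E !ReImE; ring.
Qed.

Lemma cint_sqnorm f : L2 f -> cint (fun t => f t * conjc (f t)) = (sqnorm f)%:C.
Proof.
move=> f2; under eq_fun do rewrite mulc_conj; rewrite /cint /sqnorm /=.
by rewrite Rintegral_cst//= mul0r.
Qed.

(** Discriminant argument for a quadratic whose linear and leading coefficients share the factor B.
    In its uses B is the squared modulus of a scalar product, and s = 1/C gives the minimum A -
    B/C. *)
Lemma quadratic_ge0 (A B C : R) : 0 <= C ->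
  (forall s, 0 <= A - 2 * s * B + s ^+ 2 * (B * C)) -> 0 <= B -> B <= A * C.
Proof.
move=> C0 h B0; have := h 0; rewrite !(mulr0, mul0r, expr0n, subr0, addr0) => A0.
have [C00|Cn0] := eqVneq C 0.
  have [->|Bn0] := eqVneq B 0; first by rewrite C00 mulr0.
  (* With C = 0 the expression is affine in s, and this s makes it equal to -1. *)
  have := h ((A + 1) / (2 * B)); rewrite C00 !mulr0 addr0.
  suff -> : 2 * ((A + 1) / (2 * B)) * B = A + 1 by lra.
  by field.
have Cgt0 : 0 < C by rewrite lt0r Cn0.
have := h C^-1; have -> : A - 2 * C^-1 * B + C^-1 ^+ 2 * (B * C) = A - B / C by field.
by rewrite subr_ge0 ler_pdivrMr.
Qed.

Lemma cauchy_schwarz f g : L2 f -> L2 g ->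
  normc (cint (fun t => f t * g t)) ^+ 2 <= sqnorm f * sqnorm g.
Proof.
move=> f2 g2; set c := cint _.
apply: quadratic_ge0; [exact: sqnorm_ge0| |exact: sqr_ge0] => s.
(* The integral of f g carries no conjugation, so the test vector is f - s c conj g. *)
have h2 : L2 (fun t => - s%:C * (c * conjc (g t))).
  by apply: L2Z; apply: L2Z; exact: L2_conj.
have := sqnorm_ge0 (fun t => f t + - s%:C * (c * conjc (g t))).
rewrite sqnormD// !sqnormZ//; [|exact: L2_conj|by apply: L2Z; exact: L2_conj].
rewrite sqnorm_conj normcN normc_real real_normK ?num_real//.
have -> : (fun t => f t * conjc (- s%:C * (c * conjc (g t)))) =
   (fun t => - s%:C * conjc c * (f t * g t)).
  by apply/funext => t; apply: complexP; rewrite !ReImE/=; ring.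
rewrite cintZ; last exact: L2_cintegrable.
rewrite -/c => h; apply: (le_trans h); rewrite le_eqVlt; apply/orP; left.
by apply/eqP; rewrite !normc2E !ReImE/=; ring.
Qed.

Lemma L2distE f g : L2 f -> L2 g ->
  L2dist f g = (Num.sqrt (sqnorm (fun t => f t - g t)))%:E.
Proof.
move=> f2 g2; rewrite /L2dist unlock /=.
under eq_integral do
  rewrite /= ger0_norm ?normc_ge0// powR_mulrn ?normc_ge0//=.
have /L2_integrable_normc2 fg2 := L2B f2 g2.
rewrite -(@fineK _ (\int[_]_ _ _)%E); last exact: integrable_fin_num.
by rewrite -/(Rintegral _ _ _) poweR_EFin powR12_sqrt// sqnorm_ge0.
Qed.

Lemma L2dist_lt f g (e : R) : L2 f -> L2 g -> 0 < e ->
  (L2dist f g < e%:E)%E = (sqnorm (fun t => f t - g t) < e ^+ 2).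
Proof.
move=> f2 g2 e0; rewrite L2distE// lte_fin -ltr_sqr ?nnegrE ?sqrtr_ge0 ?ltW//.
by rewrite sqr_sqrtr ?sqnorm_ge0.
Qed.

End L2Space.

(** * Completeness and projections *)

Section Completeness.
Context {R : realType}.
Local Notation m := (circle R).
Local Notation fct := (R -> R[i]).
Local Notation Re := (@complex.Re R).
Local Notation Im := (@complex.Im R).
Implicit Types f g : fct.

(** Serves wherever a fixed quantity is compared with approximations of geometric precision, in
    place of an explicit passage to the limit. *)
Lemma le0_geometric (x K q : R) : 0 <= q < 1 ->
  (forall n, x <= K * q ^+ n) -> x <= 0.
Proof.
move=> /andP[q0 q1] h; have c0 : geometric K q @ \oo --> (0 : R).
  by apply: cvg_geometric; rewrite ger0_norm.
by apply: (cvgr_to_ge c0); exact: nearW.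
Qed.

(** The sum of the increments [|u n.+1 t - u n t|] has finite integral, hence is finite almost
    everywhere; at such points the telescoping series converges absolutely. *)
Lemma ae_cvg_geometric (u : nat -> R -> R) (C q : R) : 0 <= q < 1 ->
  (forall n, rintegrable (u n)) ->
  (forall n, \int[m]_t `|u n.+1 t - u n t| <= C * q ^+ n) ->
  {ae m, forall t, cvgn (u ^~ t)}.
Proof.
move=> /andP[q0 q1] iu hu.
pose d n t := (`|u n.+1 t - u n t|)%:E.
have C0 : 0 <= C.
  by have := hu 0%N; rewrite expr0 mulr1; apply: le_trans; exact: Rintegral_ge0.
have id n : rintegrable (fun t => `|u n.+1 t - u n t|).
  by apply: rintegrable_norm; apply: rintegrableD => //; exact: rintegrableN.
have md n : measurable_fun [set: measurableTypeR R] (d n).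
  by apply/measurable_EFinP; exact: rintegrable_measurable.
pose S t := (\sum_(0 <= n <oo) d n t)%E.
have mS : measurable_fun [set: measurableTypeR R] S.
  by apply: ge0_emeasurable_sum => // k t _ _; rewrite lee_fin.
have S0 t : (0 <= S t)%E by apply: nneseries_ge0 => k _ _; rewrite lee_fin.
have iS : m.-integrable setT S.
  apply/integrableP; split => //.
  under eq_integral do rewrite gee0_abs//.
  rewrite integral_nneseries//; last by move=> n t _; rewrite lee_fin.
  apply: (@le_lt_trans _ _ (C / (1 - q))%:E); last exact: ltry.
  apply: lime_le.
    by apply: is_cvg_nneseries => n _ _; apply: integral_ge0 => t _; rewrite lee_fin.
  apply: nearW => n.
  apply: (@le_trans _ _ (\sum_(0 <= k < n) (C * q ^+ k)%:E)%E).
    apply: lee_sum => k _; rewrite -[leLHS]fineK ?lee_fin//.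
      exact: hu.
    exact: integrable_fin_num (id k).
  rewrite sumEFin lee_fin.
  have [->|qn0] := eqVneq q 0.
    rewrite subr0 divr1; case: n => [|n]; first by rewrite big_nil.
    by rewrite big_nat_recl//= expr0 mulr1 big1 ?addr0// => i _; rewrite expr0n/= mulr0.
  have q00 : 0 < q by rewrite lt0r qn0.
  have := @geometric_le_lim R n C q C0 q00; rewrite ger0_norm// => /(_ q1).
  by rewrite /series/=.
have := integrable_ae measurableT iS; apply: aeS => t /(_ I) St.
have : cvgn [normed series (telescope (u ^~ t))].
  apply: nondecreasing_is_cvgn.
    by apply: nondecreasing_series => n _ _ /=.
  exists (fine (S t)) => _ [n _ <-].
  rewrite -lee_fin fineK// /series/= -sumEFin.
  by apply: nneseries_lim_ge => k _ _; rewrite lee_fin.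
move=> /normed_cvg; rewrite telescopeK => h.
have -> : u ^~ t = (fun n => u n t - u 0%N t) \+ cst (u 0%N t).
  by apply/funext => n /=; rewrite subrK.
by apply: is_cvgD => //; exact: is_cvg_cst.
Qed.

(** From 2x <= c x^2 + 1/c and total mass 1. With the weight c = 2^n, a squared L2 bound of order
    4^-n becomes an L1 bound of order 2^-n. *)
Lemma Rintegral_normc_le f (c : R) : L2 f -> 0 < c ->
  \int[m]_t normc (f t) <= (c * sqnorm f + c^-1) / 2.
Proof.
move=> f2 c0.
have i1 := normc_cintegrable (L2_cintegrable1 f2).
have i2 := L2_integrable_normc2 f2.
have -> : (c * sqnorm f + c^-1) / 2 =
    \int[m]_t ((c * normc (f t) ^+ 2 + c^-1) / 2).
  under eq_Rintegral do rewrite mulrC.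
  rewrite RintegralZl//; last by apply: rintegrableD; [exact: rintegrableZ|exact: rintegrable_cst].
  rewrite RintegralD//; [|exact: rintegrableZ|exact: rintegrable_cst].
  by rewrite RintegralZl// Rintegral_cst//= probability_setT/= mulr1 mulrC.
apply: le_Rintegral => //.
  under eq_fun do rewrite mulrC.
  by apply: rintegrableZ; apply: rintegrableD; [exact: rintegrableZ|exact: rintegrable_cst].
move=> t _; rewrite ler_pdivlMr//.
have := sqr_ge0 (c * normc (f t) - 1); set x := normc _ => h.
rewrite -(ler_pM2l c0) [leRHS]mulrDr divff ?gt_eqF//; lra.
Qed.

(** The L1 norms of the increments are summable, so real and imaginary parts converge almost
    everywhere; Fatou's lemma then carries the Cauchy bound over to the limit. *)
Lemma riesz_fischer (u : nat -> fct) (C : R) : (forall n, L2 (u n)) ->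
  (forall n k, (n <= k)%N -> sqnorm (fun t => u k t - u n t) <= C * 4^-1 ^+ n) ->
  exists v, L2 v /\ forall n, sqnorm (fun t => u n t - v t) <= C * 4^-1 ^+ n.
Proof.
move=> u2 hu.
have h1 n : \int[m]_t normc (u n.+1 t - u n t) <= (C + 1) / 2 * 2^-1 ^+ n.
  have := @Rintegral_normc_le (fun t => u n.+1 t - u n t) (2 ^+ n) (L2B (u2 _) (u2 _)).
  rewrite exprn_gt0// => /(_ isT) h; apply: (le_trans h).
  have := hu n n.+1 (leqnSn n); rewrite exprVn => h4.
  have -> : (C + 1) / 2 * 2^-1 ^+ n = (2 ^+ n * (C / 4 ^+ n) + (2 ^+ n)^-1) / 2.
    have -> : 4 = 2 * 2 :> R by rewrite -natrM.
    by rewrite exprMn exprVn; field; rewrite expf_neq0.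
  by rewrite ler_pM2r ?invr_gt0// lerD2r ler_wpM2l// exprn_ge0.
have q12 : 0 <= (2^-1 : R) < 1 by lra.
have iR n : rintegrable (fun t => Re (u n t)) by have [] := L2_cintegrable1 (u2 n).
have iI n : rintegrable (fun t => Im (u n t)) by have [] := L2_cintegrable1 (u2 n).
have in1 n : rintegrable (fun t => normc (u n.+1 t - u n t)).
  by apply: normc_cintegrable; apply: L2_cintegrable1; exact: L2B.
have cR : {ae m, forall t, cvgn (fun n => Re (u n t))}.
  apply: (ae_cvg_geometric q12 iR) => n; apply: le_trans (h1 n).
  apply: le_Rintegral => //.
  - by apply: rintegrable_norm; apply: rintegrableD => //; exact: rintegrableN.
  - exact: in1.
  - by move=> t _; have := normc_Re (u n.+1 t - u n t); rewrite !ReImE.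
have cI : {ae m, forall t, cvgn (fun n => Im (u n t))}.
  apply: (ae_cvg_geometric q12 iI) => n; apply: le_trans (h1 n).
  apply: le_Rintegral => //.
  - by apply: rintegrable_norm; apply: rintegrableD => //; exact: rintegrableN.
  - exact: in1.
  - by move=> t _; have := normc_Im (u n.+1 t - u n t); rewrite !ReImE.
(* The upper limit is defined and measurable everywhere, also where the sequence diverges. *)
pose lm (w : nat -> R -> R) t : R := fine (limn_esup (fun n => (w n t)%:E)).
have mlm w : (forall n, rintegrable (w n)) -> measurable_fun [set: measurableTypeR R] (lm w).
  move=> iw; apply: measurableT_comp => //.
  by apply: measurable_fun_limn_esup => n; apply/measurable_EFinP; exact: rintegrable_measurable.
have clm (w : nat -> R -> R) t : cvgn (w ^~ t) -> w ^~ t @ \oo --> lm w t.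
  move=> /cvg_ex[l wl]; rewrite /lm.
  have /cvg_limn_einf_sup[_ ->] : (fun n => (w n t)%:E) @ \oo --> l%:E.
    by apply: cvg_EFin => //; exact: nearW.
  by [].
pose v t := lm (fun n t => Re (u n t)) t +i* lm (fun n t => Im (u n t)) t.
have mv : cmeas v by split; exact: mlm.
have key n : (\int[m]_t (normc (u n t - v t) ^+ 2)%:E <= (C * 4^-1 ^+ n)%:E)%E.
  (* The index n + k stays above n, so that [hu] bounds the integral of every F k. *)
  pose F k t := (normc (u n t - u (n + k)%N t) ^+ 2)%:E.
  have mF k : measurable_fun [set: measurableTypeR R] (F k).
    apply/measurable_EFinP; apply: measurable_normc2.
    by apply: cmeasD; [exact: L2_cmeas|apply: cmeasN; exact: L2_cmeas].
  have := @fatou _ _ _ m setT measurableT F mF.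
  have F0 k t : setT t -> (0 <= F k t)%E by move=> _; rewrite lee_fin sqr_ge0.
  move=> /(_ F0) fat.
  have -> : (\int[m]_t (normc (u n t - v t) ^+ 2)%:E =
      \int[m]_t limn_einf (F ^~ t))%E.
    apply: ae_eq_integral => //.
    - apply/measurable_EFinP; apply: measurable_normc2.
      by apply: cmeasD; [exact: L2_cmeas|exact: cmeasN].
    - rewrite (_ : (fun t => _) = (fun t => - limn_esup (fun k => - F k t))%E); last first.
        by apply/funext => t.
      apply: measurableT_comp => //; apply: measurable_fun_limn_esup => k.
      exact: measurableT_comp.
    - apply: aeS2 cR cI => t c1 c2 _.
      have {}c1 := clm (fun n t => Re (u n t)) t c1.
      have {}c2 := clm (fun n t => Im (u n t)) t c2.
      have /cvg_limn_einf_sup[-> _] // : F ^~ t @ \oo --> (normc (u n t - v t) ^+ 2)%:E.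
      apply: cvg_EFin; first exact: nearW.
      rewrite /F/=; under eq_cvg do rewrite /= normc2E !ReImE !expr2.
      rewrite normc2E !ReImE !expr2.
      have sh (w : nat -> R) (l : R) : w @ \oo --> l -> (fun k => w (n + k)%N) @ \oo --> l.
        by move=> wl; under eq_cvg do rewrite addnC; move: wl; rewrite -(cvg_shiftn n).
      have {}c1 := sh _ _ c1; have {}c2 := sh _ _ c2.
      by apply: cvgD; apply: cvgM; apply: cvgB; first [exact: cvg_cst|exact: c1|exact: c2].
  apply: (le_trans fat); rewrite limn_einf_lim; apply: lime_le; first exact: is_cvg_einfs.
  apply: nearW => k; apply: (@le_trans _ _ (\int[m]_t F k t)%E).
    by apply: ereal_inf_lbound; exists k => /=.
  rewrite -[leLHS]fineK; last first.
    exact: (integrable_fin_num measurableT (L2_integrable_normc2 (L2B (u2 n) (u2 (n + k)%N)))).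
  rewrite lee_fin -/(Rintegral _ _ _).
  have := hu n (n + k)%N (leq_addr _ _); apply: le_trans.
  rewrite /sqnorm le_eqVlt; apply/orP; left; apply/eqP; apply: eq_Rintegral => t _.
  by rewrite -normcN opprB.
have uv2 n : L2 (fun t => u n t - v t).
  have muv : cmeas (fun t => u n t - v t).
    by apply: cmeasD; [exact: L2_cmeas|exact: cmeasN].
  apply/L2P; split => //; apply/integrableP; split.
    by apply/measurable_EFinP; exact: measurable_normc2.
  under eq_integral do rewrite /= ger0_norm ?sqr_ge0//.
  by apply: le_lt_trans (key n) _; exact: ltry.
exists v; split.
  rewrite (_ : v = fun t => u 0%N t - (u 0%N t - v t)); first exact: L2B.
  by apply/funext => t; rewrite subKr.
move=> n; rewrite /sqnorm /Rintegral -lee_fin fineK//.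
exact: (integrable_fin_num measurableT (L2_integrable_normc2 (uv2 n))).
Qed.

End Completeness.

(** * Orthogonal projection onto the closure of a subspace *)

Section Projection.
Context {R : realType}.
Local Notation fct := (R -> R[i]).
Local Notation Re := (@complex.Re R).
Implicit Types f g : fct.

(** D is a subspace that may fail to be closed, so the nearest point p is found in its closure, as
    the limit of a minimising sequence. *)
Lemma L2_projection (D : set fct) f : L2 f -> (forall d, D d -> L2 d) ->
  D (fun=> 0) ->
  (forall d d' c, D d -> D d' -> D (fun t => d t + c * d' t)) ->
  exists p, [/\ L2 p,
    forall e : R, 0 < e -> exists2 d, D d & sqnorm (fun t => p t - d t) < e &
    forall d, D d -> cint (fun t => (f t - p t) * conjc (d t)) = 0].
Proof.
move=> f2 D2 D0 DS.
pose A := [set sqnorm (fun t => f t - d t) | d in D].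
have Alb : has_lbound A by exists 0 => _ [d _ <-]; exact: sqnorm_ge0.
have A0 : A !=set0 by eexists; exists (fun=> 0).
pose delta := inf A.
have hdelta d : D d -> delta <= sqnorm (fun t => f t - d t).
  by move=> Dd; apply: ge_inf => //; exists d.
have q0 n : 0 < 4^-1 ^+ n :> R by rewrite exprn_gt0// invr_gt0.
have /choice[d hd] n : exists d, D d /\ sqnorm (fun t => f t - d t) < delta + 4^-1 ^+ n.
  by have [_ [d Dd <-] h] := inf_adherent (q0 n) (conj A0 Alb); exists d.
have Dd n : D (d n) := (hd n).1.
have d2 n := D2 _ (Dd n).
have fd2 n : L2 (fun t => f t - d n t) by exact: L2B.
(* The midpoint of d n and d k is in D, so the parallelogram law leaves at most 2 (4^-n + 4^-k) <= 4
   * 4^-n. *)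
have cauchy n k : (n <= k)%N -> sqnorm (fun t => d k t - d n t) <= 4 * 4^-1 ^+ n.
  move=> nk; have := parallelogram (fd2 n) (fd2 k).
  have -> : (fun t => f t - d n t - (f t - d k t)) = (fun t => d k t - d n t).
    by apply/funext => t; ring.
  have -> : (fun t => f t - d n t + (f t - d k t)) =
      (fun t => 2 * (f t - (d n t + 2^-1 * (d k t - d n t)))).
    by apply/funext => t; field.
  have DM : D (fun t => d n t + 2^-1 * (d k t - d n t)).
    apply: (DS) => //; rewrite (_ : (fun t => _) = (fun t => d k t + (-1) * d n t)).
      exact: DS.
    by apply/funext => t; rewrite mulN1r.
  rewrite sqnormZ; last by apply: L2B => //; exact: D2.
  have -> : normc (2 : R[i]) ^+ 2 = 4.
    by rewrite (_ : 2 = 2%:C) ?normc_real ?ger0_norm// -?natrX// rmorph_nat.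
  have h1 := hdelta _ DM; have h2 := (hd n).2; have h3 := (hd k).2.
  have h4 : 4^-1 ^+ k <= 4^-1 ^+ n :> R by rewrite ler_wiXn2l// invf_le1 ?ler1n.
  lra.
have [p [p2 hp]] := riesz_fischer d2 cauchy.
exists p; split=> //.
  move=> e e0; apply: contrapT => /forall2NP h.
  have : e <= 0.
    apply: (@le0_geometric _ e 4 4^-1); first by apply/andP; split; lra.
    move=> n; have := hp n; apply: le_trans; rewrite leNgt; apply/negP => hn.
    have [//|] := h (d n); apply.
    by rewrite -sqnormN; under eq_fun do rewrite opprB.
  by rewrite leNgt e0.
move=> e De; set c := cint _.
have e2 := D2 _ De; have ce2 := L2_conj e2.
(* Moving d n within D along e can lower the squared distance to f by at most 4^-n; this is
   [quadratic_ge0] with A = 4^-n. *)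
have cn n : normc (cint (fun t => (f t - d n t) * conjc (e t))) ^+ 2
    <= 4^-1 ^+ n * sqnorm e.
  set cn := cint _.
  apply: quadratic_ge0; [exact: sqnorm_ge0| |exact: sqr_ge0] => s.
  have De' : D (fun t => d n t + s%:C * cn * e t) by exact: DS.
  have := hdelta _ De'.
  have -> : (fun t => f t - (d n t + s%:C * cn * e t)) =
      (fun t => (f t - d n t) + (- s%:C * cn) * e t).
    by apply/funext => t; ring.
  rewrite sqnormD//; last exact: L2Z.
  rewrite sqnormZ//.
  have -> : (fun t => (f t - d n t) * conjc (- s%:C * cn * e t)) =
    (fun t => (- s%:C * conjc cn) * ((f t - d n t) * conjc (e t))).
    by apply/funext => t; apply: complexP; rewrite !ReImE/=; ring.
  rewrite cintZ; last exact: L2_cintegrable.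
  rewrite -/cn => h; have h2 := (hd n).2.
  have -> : normc cn ^+ 2 = Re (conjc cn * cn).
    by rewrite normc2E !ReImE; ring.
  have e1 : normc (- s%:C * cn) ^+ 2 = s ^+ 2 * Re (conjc cn * cn).
    by rewrite !normc2E !ReImE/=; ring.
  have e3 : Re (- s%:C * conjc cn * cn) = - s * Re (conjc cn * cn).
    by rewrite !ReImE/=; ring.
  move: h; rewrite e1 e3; lra.
suff : normc c ^+ 2 <= 0.
  by rewrite exprn_even_le0// => h; apply/eqP; rewrite -normc_eq0.
(* 10 = 2 + 2 * 4: the factor 2 comes from [normcD2_le], the 1 from [cn] and the 4 from [hp]. *)
apply: (@le0_geometric _ _ (10 * sqnorm e) 4^-1); first by apply/andP; split; lra.
move=> n; have dp2 : L2 (fun t => d n t - p t) by exact: L2B.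
have -> : c = cint (fun t => (f t - d n t) * conjc (e t)) +
    cint (fun t => (d n t - p t) * conjc (e t)).
  rewrite -cintD; [|exact: L2_cintegrable..].
  by rewrite /c; congr cint; apply/funext => t; ring.
apply: (le_trans (normcD2_le _ _)).
have := cn n; have := cauchy_schwarz dp2 ce2; rewrite sqnorm_conj.
have := hp n; have := sqnorm_ge0 e.
set x := sqnorm (fun t => d n t - p t); set q := 4^-1 ^+ n; nra.
Qed.

End Projection.

(** * Uniqueness of Fourier coefficients *)

Section StepApproximation.
Context {R : realType}.
Implicit Types x y : R.

Lemma bernoulli_le y n : 0 <= y <= 1 -> 1 - n%:R * y <= (1 - y) ^+ n.
Proof.
move=> /andP[y0 y1]; elim: n => [|n ih]; first by rewrite mul0r subr0 expr0.
rewrite exprS -natr1.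
have : (1 - y) * (1 - n%:R * y) <= (1 - y) * (1 - y) ^+ n.
  by rewrite ler_wpM2l// subr_ge0.
apply: le_trans; have := mulr_ge0 (ler0n R n) (mulr_ge0 y0 y0); lra.
Qed.

Lemma bernoulli_ge y n : 0 <= y <= 1 -> (1 - y) ^+ n * (1 + n%:R * y) <= 1.
Proof.
move=> /andP[y0 y1]; elim: n => [|n ih].
  by rewrite mul0r addr0 expr0 mulr1.
apply: le_trans ih; rewrite exprSr -mulrA ler_wpM2l ?exprn_ge0 ?subr_ge0//.
rewrite -natr1; have := mulr_ge0 (ler0n R n) (mulr_ge0 y0 y0).
have := mulr_ge0 y0 y0; lra.
Qed.

(** The sum of y^k over k < n is (1 - y^n) / (1 - y), and each of its n terms is at least y^n. *)
Lemma natrM_geometric_le y n : 0 <= y < 1 -> n%:R * y ^+ n * (1 - y) <= 1.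
Proof.
move=> /andP[y0 y1].
have : n%:R * y ^+ n * (1 - y) <= 1 - y ^+ n.
  elim: n => [|n ih]; first by rewrite !mul0r expr0 subrr.
  rewrite exprS -natr1.
  have h : y * (n%:R * y ^+ n * (1 - y)) <= y * (1 - y ^+ n) by rewrite ler_wpM2l.
  have h2 : 0 <= (1 - y * y ^+ n) * (1 - y).
    by rewrite -exprS mulr_ge0 ?subr_ge0 ?exprn_ile1// ltW.
  lra.
by move=> h; apply: (le_trans h); rewrite gerBl exprn_ge0.
Qed.

(* With exponent n 2^n, Bernoulli's inequality decides the limit at 1/2 too. *)
Definition step_approx (n : nat) x : R := (1 - x ^+ n) ^+ (n * 2 ^ n).

Lemma step_approx_itv (n : nat) x : 0 <= x <= 1 -> 0 <= step_approx n x <= 1.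
Proof.
move=> /andP[x0 x1]; rewrite /step_approx.
have h : 0 <= 1 - x ^+ n <= 1.
  by rewrite subr_ge0 exprn_ile1//= gerBl exprn_ge0.
by case/andP: h => h0 h1; rewrite exprn_ge0//= exprn_ile1.
Qed.

(** Both Bernoulli bounds involve n (2 x)^n. Below 1/2 it tends to 0; from 1/2 on it is at least n,
    and the value is at most 1/(n+1). *)
Lemma cvg_step_approx x : 0 <= x <= 1 ->
  step_approx n x @[n --> \oo] --> ((x < 2^-1)%R%:R : R).
Proof.
move=> /[dup] x01 /andP[x0 x1].
have xn01 n : 0 <= x ^+ n <= 1 by rewrite exprn_ge0// exprn_ile1.
have [xlt|xge] /= := ltP x 2^-1.
  (* (2 x)^n = y^n y^n, and one factor y^n absorbs n by [natrM_geometric_le]. *)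
  pose y := Num.sqrt (2 * x).
  have y0 : 0 <= y by exact: sqrtr_ge0.
  have yy : y * y = 2 * x by rewrite -expr2 sqr_sqrtr// mulr_ge0.
  have y1 : y < 1 by rewrite ltNge; apply/negP => h; nra.
  have lb n : 1 - (1 - y)^-1 * y ^+ n <= step_approx n x.
    apply: le_trans (bernoulli_le _ (xn01 n)).
    rewrite lerD2l lerN2 natrM natrX -mulrA -exprMn -yy exprMn mulrA.
    rewrite ler_wpM2r ?exprn_ge0// -[leRHS]mul1r ler_pdivlMr ?subr_gt0//.
    by apply: natrM_geometric_le; rewrite y0.
  apply: (@squeeze_cvgr _ _ _ _ (fun n => 1 - (1 - y)^-1 * y ^+ n) (fun=> 1)).
  - by apply: nearW => n; rewrite lb; case/andP: (step_approx_itv n x01).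
  - rewrite -[X in _ --> X](subr0 (1 : R)); apply: cvgB; first exact: cvg_cst.
    by apply: cvg_geometric; rewrite ger0_norm.
  - exact: cvg_cst.
apply: (@squeeze_cvgr _ _ _ _ (fun=> 0) harmonic); last 2 first.
- exact: cvg_cst.
- exact: cvg_harmonic.
apply: nearW => n; case/andP: (step_approx_itv n x01) => -> _ /=.
have := bernoulli_ge (n * 2 ^ n) (xn01 n); rewrite -/(step_approx n x) => h.
rewrite -[leRHS]mul1r ler_pdivlMr ?ltr0n//; apply: le_trans h.
rewrite ler_wpM2l//; first by case/andP: (step_approx_itv n x01).
rewrite -natr1 addrC lerD2l natrM -mulrA ler_peMr//.
rewrite natrX -exprMn exprn_ege1//.
by rewrite -ler_pdivrMl// mulr1.
Qed.

End StepApproximation.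

(** * Multipliers of the annihilator of the trigonometric polynomials *)

Section FourierUniqueness.
Context {R : realType}.
Local Notation m := (circle R).
Local Notation fct := (R -> R[i]).
Local Notation Re := (@complex.Re R).
Local Notation Im := (@complex.Im R).
Implicit Types f g : fct.

Lemma normc_eit (t : R) : normc (eit t) = 1.
Proof. by rewrite /eit/= cos2Dsin2 sqrtr1. Qed.

Lemma eit_neq0 (t : R) : eit t != 0.
Proof. by rewrite -normc_eq0 normc_eit oner_eq0. Qed.

Lemma conjc_eit (t : R) : conjc (eit t) = (eit t)^-1.
Proof.
apply: (mulfI (eit_neq0 t)); rewrite mulc_conj normc_eit expr1n.
by rewrite divff// eit_neq0.
Qed.

Definition annihilated f :=
  cintegrable f /\ forall n : int, cint (fun t => f t * eit t ^ n) = 0.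

(* The annihilator of the trigonometric polynomials is a module over cos and sin,
   hence over bounded pointwise limits of polynomials in them, such as indicator
   functions of arcs. *)
Definition multiplier (v : R -> R) :=
  [/\ measurable_fun [set: measurableTypeR R] v,
      exists M, forall t, `|v t| <= M &
      forall f, annihilated f -> annihilated (fun t => f t * (v t)%:C)].

Lemma cintegrable_bounded f (v : R -> R) (M : R) :
  measurable_fun [set: measurableTypeR R] v -> (forall t, `|v t| <= M) ->
  cintegrable f -> cintegrable (fun t => f t * (v t)%:C).
Proof.
move=> mv vM fi; apply: (@cintegrable_le _ _ (fun t => M * normc (f t))).
- by apply: cmeasM; [exact: cintegrable_cmeas|exact: cmeas_real].
- by move=> t; rewrite normcM normc_real mulrC ler_wpM2r// normc_ge0.
- by apply: rintegrableZ; exact: normc_cintegrable.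
Qed.

Lemma cmeas_eitz (n : int) : cmeas (fun t : R => eit t ^ n).
Proof.
case: n => n; first by apply: cmeasX; exact: cmeas_eit.
rewrite (_ : (fun t => _) = fun t : R => conjc (eit t) ^+ n.+1).
  by apply: cmeasX; apply: cmeas_conj; exact: cmeas_eit.
by apply/funext => t; rewrite conjc_eit exprVn.
Qed.

Lemma normc_eitz (n : int) (t : R) : normc (eit t ^ n) = 1.
Proof.
case: n => n; first by rewrite -exprnP normcX normc_eit expr1n.
by rewrite NegzE -exprnN normcV normcX normc_eit expr1n invr1.
Qed.

Lemma cintegrable_eitz f (n : int) : cintegrable f ->
  cintegrable (fun t => f t * eit t ^ n).
Proof.
move=> fi; apply: (@cintegrable_le _ _ (fun t => normc (f t))).
- by apply: cmeasM; [exact: cintegrable_cmeas|exact: cmeas_eitz].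
- by move=> t; rewrite normcM normc_eitz mulr1.
- exact: normc_cintegrable.
Qed.

Lemma annihilatedD f g : annihilated f -> annihilated g ->
  annihilated (fun t => f t + g t).
Proof.
move=> [fi f0] [gi g0]; split; first exact: cintegrableD.
move=> n; under eq_fun do rewrite mulrDl.
by rewrite cintD ?f0 ?g0 ?addr0//; exact: cintegrable_eitz.
Qed.

Lemma annihilatedZ c f : annihilated f -> annihilated (fun t => c * f t).
Proof.
move=> [fi f0]; split; first exact: cintegrableZ.
move=> n; under eq_fun do rewrite -mulrA.
by rewrite cintZ ?f0 ?mulr0//; exact: cintegrable_eitz.
Qed.

Lemma annihilated_eitz f (k : int) : annihilated f ->
  annihilated (fun t => f t * eit t ^ k).
Proof.
move=> [fi f0]; split; first exact: cintegrable_eitz.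
move=> n; under eq_fun do rewrite -mulrA -expfzDr ?eit_neq0//.
exact: f0.
Qed.

Lemma multiplier_cos : multiplier cos.
Proof.
split; first exact: (continuous_measurable_fun (@continuous_cos R)).
  by exists 1 => t; exact: cos_max.
move=> f fa.
rewrite (_ : (fun t => _) = fun t : R => 2^-1 * (f t * eit t ^ (1 : int)) +
    2^-1 * (f t * eit t ^ (-1 : int))).
  by apply: annihilatedD; apply: annihilatedZ; exact: annihilated_eitz.
apply/funext => t; rewrite expr1z exprN1 -conjc_eit -!mulrDr mulrCA; congr (_ * _).
apply: (@mulfI _ 2); first by rewrite pnatr_eq0.
rewrite mulrA divff ?pnatr_eq0// mul1r mulr_natl mulr2n.
by apply: complexP; rewrite !ReImE/=; ring.
Qed.

Lemma multiplier_sin : multiplier sin.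
Proof.
split; first exact: (continuous_measurable_fun (@continuous_sin R)).
  by exists 1 => t; exact: sin_max.
move=> f fa.
rewrite (_ : (fun t => _) = fun t : R => (- 2^-1 * 'i) * (f t * eit t ^ (1 : int)) +
    (2^-1 * 'i) * (f t * eit t ^ (-1 : int))).
  by apply: annihilatedD; apply: annihilatedZ; exact: annihilated_eitz.
apply/funext => t; rewrite expr1z exprN1 -conjc_eit.
rewrite (_ : 2^-1 = (2^-1)%:C); last by rewrite fmorphV rmorph_nat.
by apply: complexP; rewrite !ReImE/=; field.
Qed.

Lemma multiplier_cst (c : R) : multiplier (fun=> c).
Proof.
split; first exact: measurable_cst.
  by exists `|c|.
move=> f fa; under eq_fun do rewrite mulrC; exact: annihilatedZ.
Qed.

Lemma multiplierM u v : multiplier u -> multiplier v ->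
  multiplier (fun t => u t * v t).
Proof.
move=> [mu [M uM] fu] [mv [K vK] fv]; split; first exact: measurable_funM.
  by exists (M * K) => t; rewrite normrM ler_pM.
by move=> f /fu/fv; under eq_fun do rewrite -mulrA -rmorphM.
Qed.

Lemma multiplierD u v : multiplier u -> multiplier v ->
  multiplier (fun t => u t + v t).
Proof.
move=> [mu [M uM] fu] [mv [K vK] fv]; split; first exact: measurable_funD.
  by exists (M + K) => t; rewrite (le_trans (ler_normD _ _))// lerD.
move=> f fa; have := annihilatedD (fu f fa) (fv f fa).
by under eq_fun do rewrite -mulrDr -rmorphD.
Qed.

Lemma multiplierB u v : multiplier u -> multiplier v ->
  multiplier (fun t => u t - v t).
Proof.
move=> hu hv; under eq_fun do rewrite -mulN1r.
by apply: multiplierD => //; apply: multiplierM => //; exact: multiplier_cst.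
Qed.

Lemma multiplierX u n : multiplier u -> multiplier (fun t => u t ^+ n).
Proof.
move=> hu; elim: n => [|n ih]; first exact: multiplier_cst.
by under eq_fun do rewrite exprS; exact: multiplierM.
Qed.

(** Dominated convergence with majorant |u|. *)
Lemma Rintegral_limit0 (u w : R -> R) (v : nat -> R -> R) : rintegrable u ->
  (forall n, measurable_fun [set: measurableTypeR R] (v n)) ->
  measurable_fun [set: measurableTypeR R] w ->
  (forall n t, 0 <= v n t <= 1) ->
  (forall t, v n t @[n --> \oo] --> w t) ->
  (forall n, \int[m]_t (u t * v n t) = 0) -> \int[m]_t (u t * w t) = 0.
Proof.
move=> iu mv mw v01 vw h; have mu := rintegrable_measurable iu.
have muv n : measurable_fun [set: measurableTypeR R] (fun t => (u t * v n t)%:E).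
  by apply/measurable_EFinP; exact: measurable_funM.
have muw : measurable_fun [set: measurableTypeR R] (fun t => (u t * w t)%:E).
  by apply/measurable_EFinP; exact: measurable_funM.
have cuv t : (u t * v n t)%:E @[n --> \oo] --> (u t * w t)%:E.
  apply: cvg_EFin; first exact: nearW.
  by apply: cvgM; [exact: cvg_cst|exact: vw].
have iun : m.-integrable setT (EFin \o (fun t => `|u t|)) := rintegrable_norm iu.
have cuv' : {ae m, forall t, setT t -> (u t * v n t)%:E @[n --> \oo] --> (u t * w t)%:E}.
  by apply: aeW => t _.
have uvu : {ae m, forall t (n : nat), setT t -> (`|(u t * v n t)%:E| <= (`|u t|)%:E)%E}.
  apply: aeW => t n _; rewrite lee_fin normrM ler_piMr//.
  by case/andP: (v01 n t) => v0 v1; rewrite ger0_norm.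
have [_ _] := dominated_convergence measurableT muv muw cuv' iun uvu.
have -> : [sequence (\int[m]_t (u t * v n t)%:E)%E]_n = cst 0%E.
  apply/funext => n /=; rewrite -[LHS]fineK.
    by rewrite -/(Rintegral _ _ _) h.
  have iuv : rintegrable (fun t => u t * v n t).
    apply: rintegrable_le iun; first exact: measurable_funM.
    move=> t; rewrite normrM ler_piMr//.
    by case/andP: (v01 n t) => v0 v1; rewrite ger0_norm.
  exact: integrable_fin_num iuv.
move=> /(cvg_unique _ (@cvg_cst _ _ _ _ _)) h0.
by rewrite /Rintegral -h0.
Qed.

Lemma multiplier_limit (v : nat -> R -> R) w :
  (forall n, multiplier (v n)) -> (forall n t, 0 <= v n t <= 1) ->
  (forall t, v n t @[n --> \oo] --> w t) -> multiplier w.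
Proof.
move=> hv v01 vw.
have mv n : measurable_fun [set: measurableTypeR R] (v n) by have [] := hv n.
have mw : measurable_fun [set: measurableTypeR R] w.
  by apply: (@measurable_fun_cvg _ _ _ _ v) => // t _; exact: vw.
have w1 t : `|w t| <= 1.
  rewrite ler_norml; apply/andP; split.
    rewrite (@le_trans _ _ 0)// ?lerN10//; apply: (cvgr_to_ge (vw t)).
    by apply: nearW => n; case/andP: (v01 n t).
  by apply: (cvgr_to_le (vw t)); apply: nearW => n; case/andP: (v01 n t).
split=> //; first by exists 1.
move=> f fa; split; first by apply: (cintegrable_bounded mw w1); case: fa.
move=> n; have [fi f0] := annihilated_eitz n fa; have [ir ii] := fi.
have vz k : cint (fun t => f t * eit t ^ n * (v k t)%:C) = 0.
  have [_ _ /(_ _ (annihilated_eitz n fa)) [_ /(_ 0)]] := hv k.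
  by under eq_fun do rewrite expr0z mulr1.
under eq_fun do rewrite mulrAC.
rewrite /cint; apply: complexP => /=.
- under eq_Rintegral do rewrite cReM/= mulr0 subr0.
  apply: (Rintegral_limit0 ir mv mw v01 vw) => k.
  have := congr1 Re (vz k); rewrite /cint/=.
  by under eq_Rintegral do rewrite cReM/= mulr0 subr0.
- under eq_Rintegral do rewrite cImM/= mulr0 add0r.
  apply: (Rintegral_limit0 ii mv mw v01 vw) => k.
  have := congr1 Im (vz k); rewrite /cint/=.
  by under eq_Rintegral do rewrite cImM/= mulr0 add0r.
Qed.

Lemma multiplier_step u : (forall t, 0 <= u t <= 1) -> multiplier u ->
  multiplier (fun t => (u t < 2^-1)%R%:R).
Proof.
move=> u01 hu; apply: (@multiplier_limit (fun n t => step_approx n (u t))).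
- move=> n; rewrite /step_approx; apply: multiplierX.
  by apply: multiplierB; [exact: multiplier_cst|exact: multiplierX].
- by move=> n t; exact: step_approx_itv.
- by move=> t; exact: cvg_step_approx.
Qed.

(** (1 - sin t) / 2 takes its values in [0, 1] and is below 1/2 exactly when sin t > 0, so
    [multiplier_step] applies. *)
Lemma multiplier_sin_gt0 : multiplier (fun t => (0 < sin t)%R%:R).
Proof.
have h : multiplier (fun t => (1 - sin t) * 2^-1).
  apply: multiplierM; last exact: multiplier_cst.
  by apply: multiplierB; [exact: multiplier_cst|exact: multiplier_sin].
have := multiplier_step _ h.
have -> : (fun t => ((1 - sin t) * 2^-1 < 2^-1 :> R)%R%:R) = (fun t => (0 < sin t)%R%:R : R).
  by apply/funext => t; rewrite gtr_pMl ?invr_gt0// ltrBlDr ltrDl.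
apply=> t; have := sin_max t; rewrite ler_norml => /andP[h1 h2].
by apply/andP; split; lra.
Qed.

Lemma multiplier_sinB_gt0 x : multiplier (fun t => (0 < sin (x - t))%R%:R).
Proof.
have h : multiplier (fun t => (1 - sin (x - t)) * 2^-1).
  apply: multiplierM; last exact: multiplier_cst.
  apply: multiplierB; first exact: multiplier_cst.
  under eq_fun do rewrite sinB.
  by apply: multiplierB; apply: multiplierM; [exact: multiplier_cst|exact: multiplier_cos
    |exact: multiplier_cst|exact: multiplier_sin].
have := multiplier_step _ h.
have -> : (fun t => ((1 - sin (x - t)) * 2^-1 < 2^-1 :> R)%R%:R) =
    (fun t => (0 < sin (x - t))%R%:R : R).
  by apply/funext => t; rewrite gtr_pMl ?invr_gt0// ltrBlDr ltrDl.
apply=> t; have := sin_max (x - t); rewrite ler_norml => /andP[h1 h2].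
by apply/andP; split; lra.
Qed.

(** For 0 < x <= pi the arc is cut out by sin t > 0 and sin (x - t) > 0. For larger x it is the
    whole upper half circle together with the part of the lower half where sin (x - t) > 0. *)
Lemma multiplier_arc x : exists2 w, multiplier w &
  forall t, 0 < t < 2 * pi -> w t = (t < x)%R%:R.
Proof.
have pi0 := pi_gt0 R.
have spos y : 0 < y < pi -> (0 < sin y)%R = true.
  by move=> h; rewrite sin_gt0_pi.
have snpos y : pi <= y <= 2 * pi -> (0 < sin y)%R = false.
  move=> h; apply/negbTE; rewrite -leNgt -(subrK pi y) sinDpi oppr_le0.
  by apply: sin_ge0_pi; lra.
have sneg y : - pi <= y <= 0 -> (0 < sin y)%R = false.
  move=> h; apply/negbTE; rewrite -leNgt -[y]opprK sinN oppr_le0.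
  by apply: sin_ge0_pi; lra.
have [x0|x0] := leP x 0.
  exists (fun=> 0); first exact: multiplier_cst.
  by move=> t /andP[t0 _]; rewrite ltNge (le_trans x0 (ltW t0)).
have [x2|x2] := leP (2 * pi) x.
  exists (fun=> 1); first exact: multiplier_cst.
  by move=> t /andP[_ t1]; rewrite (lt_le_trans t1).
have [xpi|xpi] := leP x pi.
  exists (fun t => (0 < sin t)%R%:R * (0 < sin (x - t))%R%:R).
    by apply: multiplierM; [exact: multiplier_sin_gt0|exact: multiplier_sinB_gt0].
  move=> t /andP[t0 t2]; have [tpi|tpi] := ltP t pi.
    rewrite spos ?t0// mul1r; case: (ltP t x) => tx.
      by rewrite spos//; lra.
    by rewrite sneg//; lra.
  rewrite snpos ?mul0r; last lra.
  by case: ltP => //; lra.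
exists (fun t => (0 < sin t)%R%:R + (1 - (0 < sin t)%R%:R) * (0 < sin (x - t))%R%:R).
  have h := multiplier_sin_gt0; have hx := multiplier_sinB_gt0 x.
  apply: multiplierD => //; apply: multiplierM => //.
  by apply: multiplierB => //; exact: multiplier_cst.
move=> t /andP[t0 t2]; have [tpi|tpi] := ltP t pi.
  by rewrite spos ?t0// subrr mul0r addr0 (lt_trans tpi).
rewrite snpos; last lra.
rewrite subr0 add0r mul1r; case: (ltP t x) => tx.
  by rewrite spos//; lra.
by rewrite sneg//; lra.
Qed.

End FourierUniqueness.

(** * From multipliers to almost-everywhere vanishing, through Lebesgue measure *)

Section LebesgueTransfer.
Context {R : realType}.
Local Notation m := (circle R).
Local Notation mu := (@lebesgue_measure R).
Local Notation fct := (R -> R[i]).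
Local Notation Re := (@complex.Re R).
Local Notation Im := (@complex.Im R).
Local Notation I := (`]0 : R, 2 * pi[%classic).
Implicit Types f g : fct.

Lemma ge0_integral_circle (u : R -> \bar R) :
  measurable_fun [set: measurableTypeR R] u -> (forall t, 0 <= u t)%E ->
  (\int[m]_t u t = ((2 * pi)^-1)%:E * \int[mu]_(t in I) u t)%E.
Proof.
move=> mu_ u0; rewrite /circle integral_uniform// subr0; congr (_ * _)%E.
rewrite -integral_itv_bndo_bndc; last exact: measurable_funTS.
by rewrite -integral_itv_obnd_cbnd//; exact: measurable_funTS.
Qed.

Lemma rintegrable_lebesgue (u : R -> R) : rintegrable u -> mu.-integrable I (EFin \o u).
Proof.
move=> /integrableP[mu_ iu]; apply/integrableP; split; first exact: measurable_funTS.
move: iu; rewrite ge0_integral_circle//; last exact: measurableT_comp.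
set J := (\int[mu]_(_ in _) _)%E; rewrite -/J.
have J0 : (0 <= J)%E by exact: integral_ge0.
case: J J0 => [r| |]//= _; first by move=> _; exact: ltry.
by rewrite mulry gtr0_sg ?mul1e// invr_gt0 two_pi_gt0.
Qed.

Lemma Rintegral_circle (u : R -> R) : rintegrable u ->
  \int[m]_t u t = (2 * pi)^-1 * \int[mu]_(t in I) u t.
Proof.
move=> /[dup] iu /rintegrable_lebesgue iuI.
have mu_ : measurable_fun [set: measurableTypeR R] (EFin \o u) by case/integrableP: iu.
rewrite /Rintegral integralE [in RHS]integralE.
rewrite !ge0_integral_circle//; [|exact: measurable_funeneg|exact: measurable_funepos].
have mI : measurable (I : set (measurableTypeR R)) by exact: measurable_itv.
have ip := integrable_fin_num mI (integrable_funepos mI iuI).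
have in_ := integrable_fin_num mI (integrable_funeneg mI iuI).
have fB (c : R) (x y : \bar R) : x \is a fin_num -> y \is a fin_num ->
    fine (c%:E * x - c%:E * y)%E = c * fine (x - y)%E.
  by move: x y => [x| |] [y| |]//= _ _; rewrite mulrBr.
exact: fB.
Qed.

(** Indicators of arcs starting at 0 are multipliers, so the primitive of u on the period is
    identically zero; by Lebesgue differentiation its derivative is u almost everywhere. *)
Lemma rintegrable_eq0 (u : R -> R) : rintegrable u ->
  (forall w, multiplier w -> \int[m]_t (u t * w t) = 0) ->
  {ae m, forall t, u t = 0}.
Proof.
move=> iu hw; have iuI := rintegrable_lebesgue iu; have mu_ := rintegrable_measurable iu.
have mI : measurable (I : set (measurableTypeR R)) by exact: measurable_itv.
pose v := u \_ I.
have iv : mu.-integrable setT (EFin \o v).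
  have := (@integrable_mkcond _ _ _ mu I (EFin \o u) mI).1 iuI.
  by rewrite restrict_EFin.
have F0 x : \int[mu]_(t in `]-oo, x]) v t = 0.
  have ivx : mu.-integrable `]-oo, x[ (EFin \o v) by exact: integrableS iv.
  rewrite -Rintegral_itv_bndo_bndc// Rintegral_mkcond.
  have [w hm wx] := multiplier_arc x.
  have [mw [M wM] _] := hm.
  (* The multiplier w is known only on ]0, 2 pi[, and v is zero outside it. *)
  have -> : v \_ `]-oo, x[ = (fun t => u t * w t) \_ I.
    apply/funext => t; rewrite /v !patchE.
    case: (boolP (t \in I)) => [|tI]; last by case: ifP.
    rewrite inE/= in_itv/= => tI; rewrite wx//; case: ifPn.
      by rewrite inE/= in_itv/= => ->; rewrite mulr1.
    by rewrite notin_setE/= in_itv/= => /negP/negbTE ->; rewrite mulr0.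
  rewrite -Rintegral_mkcond.
  have iuw : rintegrable (fun t => u t * w t).
    apply: (@rintegrable_le _ _ (fun t => M * `|u t|)).
    - exact: measurable_funM.
    - by move=> t; rewrite normrM mulrC ler_wpM2r.
    - by apply: rintegrableZ; exact: rintegrable_norm.
  have := Rintegral_circle iuw; rewrite (hw w hm) => /esym/eqP.
  by rewrite mulf_eq0 invr_eq0 gt_eqF ?two_pi_gt0//= => /eqP.
have loc : locally_integrable [set: R] v.
  by apply: integrable_locally => //; exact: measurable_itv.
have ivy y : mu.-integrable `]-oo, y] (EFin \o v) by exact: integrableS iv.
have := FTC1Ny ivy loc.
rewrite (_ : (fun x => _) = cst 0); last by apply/funext => x; exact: F0.
move=> v0.
have v0' : ae_eq mu I (EFin \o u) (cst 0%E).
  apply: (@filterS _ _ (@ae_filter_ringOfSetsType _ (measurableTypeR R) R mu)) v0.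
  move=> t [_ h] tI /=; congr EFin; move: h.
  by rewrite derive1_cst /v patchE mem_set.
have iu0 : (\int[m]_t `|(u t)%:E| = 0)%E.
  rewrite ge0_integral_circle//; last first.
    by apply: measurableT_comp => //; exact/measurable_EFinP.
  rewrite (ae_eq_integral_abs mu mI _).2 ?mule0//.
  by apply: measurable_funTS; exact/measurable_EFinP.
have := (ae_eq_integral_abs m measurableT _).1 iu0.
move=> /(_ ltac:(exact/measurable_EFinP)).
by apply: aeS => t /(_ Logic.I) [].
Qed.

(** Multipliers are real-valued, so the vanishing of the integral of f w splits into real and
    imaginary parts. *)
Lemma annihilated_eq0 f : annihilated f -> {ae m, forall t, f t = 0}.
Proof.
move=> /[dup] fa [[ir ii] _].
have fw w : multiplier w -> cint (fun t => f t * (w t)%:C) = 0.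
  move=> [_ _ /(_ f fa) [_ /(_ 0)]].
  by under eq_fun do rewrite expr0z mulr1.
have r0 : {ae m, forall t, Re (f t) = 0}.
  apply: rintegrable_eq0 ir _ => w /fw /(congr1 Re); rewrite /cint/=.
  by under eq_Rintegral do rewrite cReM/= mulr0 subr0.
have i0 : {ae m, forall t, Im (f t) = 0}.
  apply: rintegrable_eq0 ii _ => w /fw /(congr1 Im); rewrite /cint/=.
  by under eq_Rintegral do rewrite cImM/= mulr0 add0r.
by apply: aeS2 r0 i0 => t r0 i0; exact: complexP.
Qed.

Lemma eitX (t : R) n : eit t ^+ n = cos (n%:R * t) +i* sin (n%:R * t).
Proof.
elim: n => [|n ih]; first by rewrite expr0 mul0r cos0 sin0.
rewrite exprS ih -natr1 mulrDl mul1r addrC cosD sinD.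
by apply: complexP; rewrite !ReImE/=; ring.
Qed.

Lemma cint_eitX n : cint (fun t : R => eit t ^+ n.+1) = 0.
Proof.
set k : R := n.+1%:R.
have k0 : k != 0 by rewrite pnatr_eq0.
have pi0 := two_pi_gt0 R.
have dk (t : R) : is_derive t 1 (fun x : R => k * x) k.
  by apply: is_derive_eq; rewrite /GRing.scale/= mulr1.
have cF (F f : R -> R) : (forall t : R, is_derive t 1 F (f t)) -> continuous f ->
    F 0 = F (2 * pi) -> \int[mu]_(t in I) f t = 0.
  move=> dF cf F0; rewrite /Rintegral.
  have mf : measurable_fun [set: R] f by exact: continuous_measurable_fun.
  rewrite integral_itv_obnd_cbnd; last by apply: measurable_funTS; exact/measurable_EFinP.
  rewrite integral_itv_bndo_bndc; last by apply: measurable_funTS; exact/measurable_EFinP.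
  have dFt (t : R) : derivable F t 1 by have [] := dF t.
  have cFt : continuous F.
    by move=> t; apply: differentiable_continuous; apply/derivable1_diffP.
  rewrite (@continuous_FTC2 _ f F)//.
  - by rewrite -EFinB F0 subrr.
  - exact: continuous_subspaceT.
  - split=> //.
      by apply: cvg_at_right_filter; exact: cFt.
    by apply: cvg_at_left_filter; exact: cFt.
  - by move=> t _; rewrite derive1E; have h := dF t; rewrite derive_val.
have k2pi : k * (2 * pi) = pi *+ 2 *+ n.+1.
  by rewrite /k [n.+1%:R * _]mulr_natl [2 * pi]mulr_natl.
have sink2 : sin (k * (2 * pi)) = 0.
  rewrite k2pi; elim: n.+1 => [|j ih]; first by rewrite mulr0n sin0.
  by rewrite mulrS sinD ih -[pi *+ 2]add0r sinD2pi sin0 mulr0 mul0r addr0.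
have cosk2 : cos (k * (2 * pi)) = 1.
  rewrite k2pi; elim: n.+1 => [|j ih]; first by rewrite mulr0n cos0.
  by rewrite mulrS addrC cosD2pi.
have ck : continuous (fun t : R => k * t).
  by move=> t; apply: cvgM; [exact: cvg_cst|exact: cvg_id].
have cck : continuous (fun t : R => cos (k * t)).
  by move=> t; apply: continuous_comp; [exact: ck|exact: continuous_cos].
have csk : continuous (fun t : R => sin (k * t)).
  by move=> t; apply: continuous_comp; [exact: ck|exact: continuous_sin].
have icos : rintegrable (fun t => cos (k * t)).
  apply: (@rintegrable_le _ _ (fun=> 1)); last exact: rintegrable_cst.
    exact: continuous_measurable_fun.
  by move=> t; exact: cos_max.
have isin : rintegrable (fun t => sin (k * t)).
  apply: (@rintegrable_le _ _ (fun=> 1)); last exact: rintegrable_cst.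
    exact: continuous_measurable_fun.
  by move=> t; exact: sin_max.
have dsin (t : R) : is_derive t 1 (fun t : R => k^-1 * sin (k * t)) (cos (k * t)).
  have h := is_derive1_comp (is_derive_sin (k * t)) (dk t).
  by apply: is_derive_eq; rewrite /GRing.scale/=; field.
have dcos (t : R) : is_derive t 1 (fun t : R => - k^-1 * cos (k * t)) (sin (k * t)).
  have h := is_derive1_comp (is_derive_cos (k * t)) (dk t).
  by apply: is_derive_eq; rewrite /GRing.scale/=; field.
apply: complexP => /=.
- under eq_Rintegral do rewrite eitX /=.
  rewrite Rintegral_circle// (cF _ _ dsin cck)//.
  + by rewrite mulr0.
  + by rewrite mulr0 sin0 sink2.
- under eq_Rintegral do rewrite eitX /=.
  rewrite Rintegral_circle// (cF _ _ dcos csk)//.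
  + by rewrite mulr0.
  + by rewrite mulr0 cos0 cosk2.
Qed.

End LebesgueTransfer.

(** * Analytic and coanalytic functions *)

Section Analytic.
Context {R : realType}.
Local Notation m := (circle R).
Local Notation fct := (R -> R[i]).
Implicit Types f g : fct.

(** Vanishing of the negative coefficients here, of the nonnegative ones in [coanalytic]. The shift
    [n.+1] against [n] puts the constants on the analytic side, as in H^2_- = conj H^2_0. *)
Definition analytic f :=
  L2 f /\ forall n, cint (fun t => f t * eit t ^+ n.+1) = 0.

Definition coanalytic f :=
  L2 f /\ forall n, cint (fun t => f t * conjc (eit t ^+ n)) = 0.

Lemma eitK (t : R) : eit t * conjc (eit t) = 1.
Proof. by rewrite conjc_eit divff// eit_neq0. Qed.

Lemma Linfty_eitX n : Linfty (fun t : R => eit t ^+ n).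
Proof.
apply/LinftyP; split; first by apply: cmeasX; exact: cmeas_eit.
by exists 1; apply: aeW => t; rewrite normcX normc_eit expr1n.
Qed.

Lemma L2_eitX f n : L2 f -> L2 (fun t => f t * eit t ^+ n).
Proof.
by move=> f2; under eq_fun do rewrite mulrC; apply: LinftyM => //; exact: Linfty_eitX.
Qed.

Lemma sqnorm_eitX n : sqnorm (fun t : R => eit t ^+ n) = 1.
Proof.
rewrite /sqnorm; under eq_Rintegral do rewrite normcX normc_eit !expr1n.
by rewrite Rintegral_cst//= probability_setT mulr1.
Qed.

Lemma Linfty_poly (p : {poly R[i]}) : Linfty (fun t : R => p.[eit t]).
Proof.
elim/poly_ind: p => [|p c ih].
  by under eq_fun do rewrite horner0; exact: Linfty_cst.
under eq_fun do rewrite hornerMXaddC.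
apply/LinftyP; have /LinftyP[m1 [M hM]] := Linfty_mul ih (Linfty_eitX 1).
split; first by apply: cmeasD; [exact: m1|exact: cmeas_cst].
exists (M + normc c); apply: aeS hM => t hM.
by rewrite (le_trans (normcD _ _))// lerD2r.
Qed.

Lemma L2_poly (p : {poly R[i]}) : L2 (fun t : R => p.[eit t]).
Proof. by apply: Linfty_L2; exact: Linfty_poly. Qed.

Lemma analytic_poly (p : {poly R[i]}) : analytic (fun t => p.[eit t]).
Proof.
split; first exact: L2_poly.
elim/poly_ind: p => [|p c ih] n.
  by under eq_fun do rewrite horner0 mul0r; exact: cint0.
under eq_fun do rewrite hornerMXaddC mulrDl -mulrA -exprS.
have z2 : L2 (fun t : R => eit t ^+ n.+1) by apply: Linfty_L2; exact: Linfty_eitX.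
rewrite cintD.
- by rewrite ih add0r cintZ ?cint_eitX ?mulr0//; exact: L2_cintegrable1.
- by apply: L2_cintegrable1; apply: L2_eitX; exact: L2_poly.
- by apply: cintegrableZ; exact: L2_cintegrable1.
Qed.

Lemma analytic_eit n : analytic (fun t : R => eit t ^+ n).
Proof.
rewrite (_ : (fun t => _) = fun t => ('X^n : {poly R[i]}).[eit t]).
  exact: analytic_poly.
by apply/funext => t; rewrite hornerXn.
Qed.

Lemma analyticD f g : analytic f -> analytic g -> analytic (fun t => f t + g t).
Proof.
move=> [f2 f0] [g2 g0]; split; first exact: L2D.
move=> n; under eq_fun do rewrite mulrDl.
by rewrite cintD ?f0 ?g0 ?addr0//; apply: L2_cintegrable1; exact: L2_eitX.
Qed.

Lemma analyticZ c f : analytic f -> analytic (fun t => c * f t).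
Proof.
move=> [f2 f0]; split; first exact: L2Z.
move=> n; under eq_fun do rewrite -mulrA.
by rewrite cintZ ?f0 ?mulr0//; apply: L2_cintegrable1; exact: L2_eitX.
Qed.

Lemma analyticB f g : analytic f -> analytic g -> analytic (fun t => f t - g t).
Proof.
by move=> fa ga; under eq_fun do rewrite -mulN1r; apply: analyticD => //; exact: analyticZ.
Qed.

Lemma analytic_cst c : analytic (fun=> c).
Proof. by have := analytic_poly c%:P; under eq_fun do rewrite hornerC. Qed.

Lemma analytic_eitX f n : analytic f -> analytic (fun t => f t * eit t ^+ n).
Proof.
move=> [f2 f0]; split; first exact: L2_eitX.
by move=> k; under eq_fun do rewrite -mulrA -exprD addnS; exact: f0.
Qed.

Lemma analytic_ae f g : cmeas g -> {ae m, forall t, f t = g t} ->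
  analytic f -> analytic g.
Proof.
move=> mg fg [f2 f0]; have g2 := L2_ae mg fg f2.
split=> // n; rewrite -(f0 n); apply: cint_ae.
- by apply: L2_cmeas; exact: L2_eitX.
- by apply: L2_cmeas; exact: L2_eitX.
- by apply: aeS fg => t ->.
Qed.

Lemma coanalytic_ae f g : cmeas g -> {ae m, forall t, f t = g t} ->
  coanalytic f -> coanalytic g.
Proof.
move=> mg fg [f2 f0]; have g2 := L2_ae mg fg f2.
split=> // n; rewrite -(f0 n); apply: cint_ae.
- by apply: cmeasM; [exact: L2_cmeas|apply: cmeas_conj; apply: cmeasX; exact: cmeas_eit].
- by apply: cmeasM; [exact: L2_cmeas|apply: cmeas_conj; apply: cmeasX; exact: cmeas_eit].
- by apply: aeS fg => t ->.
Qed.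

Lemma normc2_small_eq0 (c : R[i]) : (forall e : R, 0 < e -> normc c ^+ 2 <= e) -> c = 0.
Proof.
move=> h; apply/eqP; rewrite -normc_eq0 -sqrf_eq0 eq_le sqr_ge0 andbT.
by apply/ler_addgt0Pr => e e0; rewrite add0r h.
Qed.

Lemma analytic_limit f : L2 f ->
  (forall e : R, 0 < e -> exists2 g, analytic g & sqnorm (fun t => f t - g t) < e) ->
  analytic f.
Proof.
move=> f2 h; split=> // n; apply: normc2_small_eq0 => e /h[g [g2 g0] fg].
have := @cauchy_schwarz _ (fun t => f t - g t) (fun t => eit t ^+ n.+1) (L2B f2 g2)
  (Linfty_L2 (Linfty_eitX _)).
rewrite sqnorm_eitX mulr1; under [in cint _]eq_fun do rewrite mulrBl.
rewrite cintD; [|by apply: L2_cintegrable1; exact: L2_eitX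
  |by apply: L2_cintegrable1; apply: L2N; exact: L2_eitX].
rewrite cintN ?g0 ?subr0; last by apply: L2_cintegrable1; exact: L2_eitX.
by move=> /le_trans; apply; exact: ltW.
Qed.

(** Continuity of the scalar product, in the form that density arguments use. *)
Lemma cint_conj_limit0 f g : L2 f -> L2 g ->
  (forall e : R, 0 < e -> exists2 d, L2 d &
    cint (fun t => f t * conjc (d t)) = 0 /\ sqnorm (fun t => g t - d t) < e) ->
  cint (fun t => f t * conjc (g t)) = 0.
Proof.
move=> f2 g2 h; apply: normc2_small_eq0 => e e0.
have Nf0 := sqnorm_ge0 f.
(* The added 1 covers the case where f has norm 0. *)
have e1 : 0 < e / (sqnorm f + 1) by rewrite divr_gt0//; lra.
have [d d2 [fd hd]] := h _ e1.
have := cauchy_schwarz f2 (L2_conj (L2B g2 d2)); rewrite sqnorm_conj.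
have -> : (fun t => f t * conjc (g t - d t)) =
   (fun t => f t * conjc (g t) + - (f t * conjc (d t))).
  by apply/funext => t; rewrite rmorphB/= mulrBr.
have fd_int : cintegrable (fun t => f t * conjc (d t)).
  by apply: L2_cintegrable => //; exact: L2_conj.
rewrite cintD; [|by apply: L2_cintegrable => //; exact: L2_conj|exact: cintegrable_opp].
rewrite cintN// fd subr0 => /le_trans; apply.
have : sqnorm f * sqnorm (fun t => g t - d t) <= sqnorm f * (e / (sqnorm f + 1)).
  by rewrite ler_wpM2l// ltW.
move=> /le_trans; apply; rewrite mulrA ler_pdivrMr; last lra.
by rewrite mulrDr mulr1 mulrC lerDl ltW.
Qed.

Lemma inner_coanalytic_of_poly_limit f g : coanalytic f -> analytic g ->
  (forall e : R, 0 < e -> exists p : {poly R[i]}, sqnorm (fun t => g t - p.[eit t]) < e) ->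
  cint (fun t => f t * conjc (g t)) = 0.
Proof.
move=> [f2 f0] [g2 _] h.
have zf2 n : L2 (fun t => f t * conjc (eit t ^+ n)).
  under eq_fun do rewrite mulrC; apply: LinftyM => //; apply: Linfty_conj.
  exact: Linfty_eitX.
(* The exponent n is general because peeling a factor 'X off p raises it by one. *)
have fp (p : {poly R[i]}) n :
    cint (fun t => f t * conjc (eit t ^+ n) * conjc (p.[eit t])) = 0.
  elim/poly_ind: p n => [|p c ih] n.
    by under eq_fun do rewrite horner0 conjc0 mulr0; exact: cint0.
  have -> : (fun t => f t * conjc (eit t ^+ n) * conjc ((p * 'X + c%:P).[eit t])) =
    (fun t => f t * conjc (eit t ^+ n.+1) * conjc (p.[eit t]) +
      conjc c * (f t * conjc (eit t ^+ n))).
    apply/funext => t; rewrite hornerMXaddC exprS !rmorphM !rmorphD !rmorphM/=; ring.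
  rewrite cintD ?ih ?add0r.
  - by rewrite cintZ ?f0 ?mulr0//; exact: L2_cintegrable1.
  - by apply: L2_cintegrable => //; apply: L2_conj; exact: L2_poly.
  - by apply: cintegrableZ; exact: L2_cintegrable1.
apply: cint_conj_limit0 => // e /h[p hp].
exists (fun t => p.[eit t]); first exact: L2_poly.
by split=> //; have := fp p 0%N; under eq_fun do rewrite expr0 conjc1 mulr1.
Qed.

(** Here q is the projection onto the closure of the polynomials; being orthogonal to every z^n is
    coanalyticity of the remainder. Both the existence of P^+ f and the density of polynomials come
    from this splitting. *)
Lemma poly_projection f : L2 f ->
  exists q, [/\ analytic q,
    forall e : R, 0 < e -> exists p : {poly R[i]}, sqnorm (fun t => q t - p.[eit t]) < e &
    coanalytic (fun t => f t - q t)].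
Proof.
move=> f2; pose D := [set d : fct | exists p : {poly R[i]}, d = fun t => p.[eit t]].
have [q [q2 qD qo]] : exists p, [/\ L2 p,
    forall e : R, 0 < e -> exists2 d, D d & sqnorm (fun t => p t - d t) < e &
    forall d, D d -> cint (fun t => (f t - p t) * conjc (d t)) = 0].
  apply: L2_projection => //.
  - by move=> _ [p ->]; exact: L2_poly.
  - by exists 0; apply/funext => t; rewrite horner0.
  - move=> _ _ c [p ->] [p' ->]; exists (p + c *: p'); apply/funext => t.
    by rewrite hornerD hornerZ.
have qa : analytic q.
  apply: analytic_limit => // e /qD[_ [p ->] qp].
  by exists (fun t => p.[eit t]) => //; exact: analytic_poly.
exists q; split=> //.
  by move=> e /qD[_ [p ->] qp]; exists p.
split; first exact: L2B.
by move=> n; apply: qo; exists 'X^n; apply/funext => t; rewrite hornerXn.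
Qed.

(** Together the two conditions cover every integer frequency. *)
Lemma analytic_coanalytic_eq0 f : analytic f -> coanalytic f ->
  {ae m, forall t, f t = 0}.
Proof.
move=> [f2 f0] [_ g0]; apply: annihilated_eq0.
split; first exact: L2_cintegrable1.
case=> [[|n]|n].
- by have := g0 0%N; under eq_fun do rewrite expr0 rmorph1.
- exact: f0.
- rewrite -(g0 n.+1); congr cint; apply/funext => t.
  by rewrite NegzE -exprnN -exprVn -conjc_eit -rmorphXn.
Qed.

(** The difference between f and its projection onto the closure of the polynomials is both analytic
    and coanalytic, hence zero. *)
Lemma analytic_poly_dense f : analytic f ->
  forall e : R, 0 < e -> exists p : {poly R[i]}, sqnorm (fun t => f t - p.[eit t]) < e.
Proof.
move=> fa; have [f2 _] := fa; have [q [qa qp fq]] := poly_projection f2.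
have h := analytic_coanalytic_eq0 (analyticB fa qa) fq.
move=> e /qp[p hp]; exists p; apply: le_lt_trans hp; rewrite le_eqVlt; apply/orP; left.
have [q2 _] := qa; have p2 := L2_poly p.
apply/eqP; apply: sqnorm_ae; [by apply: L2_cmeas; exact: L2B..|].
by apply: aeS h => t /eqP; rewrite subr_eq0 => /eqP ->.
Qed.

Lemma inner_coanalytic f g : coanalytic f -> analytic g ->
  cint (fun t => f t * conjc (g t)) = 0.
Proof.
by move=> fc ga; apply: inner_coanalytic_of_poly_limit => //; exact: analytic_poly_dense.
Qed.

(** Pairing f conj g with z^n is pairing f with the analytic function g z^n. *)
Lemma coanalyticM f g : coanalytic f -> analytic g ->
  L2 (fun t => f t * conjc (g t)) -> coanalytic (fun t => f t * conjc (g t)).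
Proof.
move=> fc ga fg2; split=> // n.
under eq_fun do rewrite -mulrA -rmorphM.
by apply: inner_coanalytic => //; exact: analytic_eitX.
Qed.

Lemma analyticM f g : analytic f -> analytic g ->
  L2 (fun t => f t * g t) -> analytic (fun t => f t * g t).
Proof.
move=> [f2 f0] ga fg2; split=> // n.
(* Pairing this function with g gives the conjugate of the coefficient that has to vanish. *)
have fc : coanalytic (fun t => conjc (f t * eit t ^+ n.+1)).
  split; first by apply: L2_conj; exact: L2_eitX.
  move=> k; under eq_fun do rewrite -rmorphM -mulrA -exprD addSn.
  rewrite cint_conj ?f0 ?conjc0//.
  by apply: L2_cintegrable1; exact: L2_eitX.
have := inner_coanalytic fc ga; under eq_fun do rewrite -rmorphM.
rewrite cint_conj; last first.
  by apply: L2_cintegrable; [exact: L2_eitX|case: ga].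
move=> /eqP; rewrite conjc_eq0 => /eqP h; rewrite -[RHS]h; congr cint.
by apply/funext => t; rewrite mulrAC.
Qed.

End Analytic.

(** * Power series and boundary values *)

Section PowerSeries.
Context {R : realType}.
Local Notation m := (circle R).
Local Notation fct := (R -> R[i]).
Local Notation Re := (@complex.Re R).
Local Notation Im := (@complex.Im R).
Implicit Types f g : fct.

(** [disc_series] is pointwise convergence. Convergence at a single point s > r bounds the
    coefficients by a multiple of s^-k, which gives a rate uniform on the circle of radius r. *)
Lemma disc_series_bound (c : nat -> R[i]) F (r : R) : disc_series c F -> 0 < r < 1 ->
  exists K q : R, [/\ 0 <= q < 1, 0 <= K & forall n t,
    normc (F (r%:C * eit t) - \sum_(k < n) c k * (r%:C * eit t) ^+ k) <= K * q ^+ n].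
Proof.
move=> hF /andP[r0 r1]; pose s := (1 + r) / 2.
have s0 : 0 < s by rewrite /s; lra.
have s1 : s < 1 by rewrite /s; lra.
have rs : r < s by rewrite /s; lra.
have := hF s%:C; rewrite normc_real gtr0_norm// => /(_ s1) cs.
have /cvg_seq_bounded[M0 [_ hM0]] : cvgn (fun n =>
    normc (F s%:C - \sum_(k < n) c k * s%:C ^+ k)) by apply/cvg_ex; exists 0.
pose M := `|M0| + 1.
have hM n : normc (F s%:C - \sum_(k < n) c k * s%:C ^+ k) <= M.
  have M0M : M0 < M by rewrite /M (le_lt_trans (ler_norm _))// ltrDl.
  by have := hM0 M M0M n I; rewrite /= ger0_norm ?normc_ge0.
have M_ge0 : 0 <= M by rewrite addr_ge0.
have cb n : normc (c n) * s ^+ n <= 2 * M.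
  have -> : normc (c n) * s ^+ n = normc (c n * s%:C ^+ n).
    by rewrite normcM normcX normc_real gtr0_norm.
  have -> : c n * s%:C ^+ n = (F s%:C - \sum_(k < n) c k * s%:C ^+ k) +
     - (F s%:C - \sum_(k < n.+1) c k * s%:C ^+ k).
    by rewrite big_ord_recr/=; ring.
  rewrite (le_trans (normcD _ _))// normcN.
  have := hM n; have := hM n.+1; lra.
pose q := r / s.
have q0 : 0 <= q by rewrite divr_ge0 ?ltW.
have q1 : q < 1 by rewrite ltr_pdivrMr// mul1r.
have cq n : normc (c n) * r ^+ n <= 2 * M * q ^+ n.
  rewrite /q expr_div_n mulrA ler_pdivlMr ?exprn_gt0//.
  by rewrite mulrAC ler_wpM2r// exprn_ge0// ltW.
pose K := 2 * M / (1 - q).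
have K0 : 0 <= K by rewrite divr_ge0 ?mulr_ge0// subr_ge0 ltW.
exists K, q; split; [by rewrite q0|by []|].
move=> n t; set w := r%:C * eit t.
pose S n := \sum_(k < n) c k * w ^+ k.
(* The factor 1 - q^j makes the induction close exactly, since K (1 - q) = 2 M. *)
have tail j : normc (S (n + j)%N - S n) <= K * q ^+ n * (1 - q ^+ j).
  elim: j => [|j ih]; first by rewrite addn0 !subrr normc0 mulr0.
  rewrite addnS /S big_ord_recr/= -/(S _) addrAC (le_trans (normcD _ _))//.
  have h : normc (c (n + j)%N * w ^+ (n + j)) <= K * q ^+ n * (q ^+ j * (1 - q)).
    rewrite normcM normcX /w normcM normc_real normc_eit mulr1 gtr0_norm//.
    rewrite (le_trans (cq _))// exprD /K.
    by rewrite le_eqVlt; apply/orP; left; apply/eqP; field; rewrite subr_eq0 gt_eqF.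
  by apply: le_trans (lerD ih h) _; rewrite exprSr; lra.
have w1 : normc w < 1 by rewrite /w normcM normc_real normc_eit mulr1 gtr0_norm.
have cw := hF w w1.
apply/ler_addgt0Pr => e e0.
have /cvgrPdist_lt/(_ e e0)[j _ /(_ (n + j)%N (leq_addl _ _)) hj] := cw.
have -> : F w - \sum_(k < n) c k * w ^+ k = (S (n + j)%N - S n) + (F w - S (n + j)%N).
  by rewrite -/(S n); ring.
apply: le_trans (normcD _ _) _; apply: lerD.
  apply: le_trans (tail j) _; apply: ler_piMr.
    by rewrite mulr_ge0// exprn_ge0.
  by rewrite gerBl exprn_ge0.
by apply: ltW; move: hj; rewrite /= sub0r normrN ger0_norm ?normc_ge0.
Qed.

(** Provides the measurability of dilates, the u n being the partial sums of a power series. *)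
Lemma cmeas_limit (u : nat -> fct) f (K q : R) : 0 <= q < 1 ->
  (forall n, cmeas (u n)) -> (forall n t, normc (f t - u n t) <= K * q ^+ n) -> cmeas f.
Proof.
move=> /andP[q0 q1] mu hu.
have c0 : (fun n => K * q ^+ n) @ \oo --> (0 : R).
  by apply: cvg_geometric; rewrite ger0_norm.
have sq (v : R) (w : nat -> R) : (forall n, `|v - w n| <= K * q ^+ n) -> w @ \oo --> v.
  move=> h; apply: (@squeeze_cvgr _ _ _ _ (fun n => v - K * q ^+ n) (fun n => v + K * q ^+ n)).
  - by apply: nearW => n; rewrite -ler_distlC h.
  - by rewrite -[X in _ --> X]subr0; apply: cvgB => //; exact: cvg_cst.
  - by rewrite -[X in _ --> X]addr0; apply: cvgD => //; exact: cvg_cst.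
split.
- apply: (@measurable_fun_cvg _ _ _ _ (fun n t => Re (u n t))).
    by move=> n; have [] := mu n.
  move=> t _; apply: sq => n; apply: le_trans (hu n t).
  by have := normc_Re (f t - u n t); rewrite !ReImE.
- apply: (@measurable_fun_cvg _ _ _ _ (fun n t => Im (u n t))).
    by move=> n; have [] := mu n.
  move=> t _; apply: sq => n; apply: le_trans (hu n t).
  by have := normc_Im (f t - u n t); rewrite !ReImE.
Qed.

Lemma dilate_poly (c : nat -> R[i]) (r : R) n t :
  \sum_(k < n) c k * (r%:C * eit t) ^+ k = (\poly_(k < n) (c k * r%:C ^+ k)).[eit t].
Proof.
by rewrite horner_poly; apply: eq_bigr => k _; rewrite exprMn mulrA.
Qed.

Lemma sqnorm_le_unif f (B : R) : cmeas f -> (forall t, normc (f t) <= B) -> sqnorm f <= B ^+ 2.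
Proof.
move=> mf h; have hB t : normc (f t) ^+ 2 <= B ^+ 2.
  by rewrite ler_sqr ?nnegrE ?normc_ge0// (le_trans _ (h t))// normc_ge0.
have ib : rintegrable (fun=> B ^+ 2 : R) by exact: rintegrable_cst.
rewrite /sqnorm -[leRHS]mulr1 (_ : 1 = fine (m setT)); last by rewrite probability_setT.
rewrite -(Rintegral_cst m measurableT); apply: le_Rintegral => //.
apply: rintegrable_le ib; first exact: measurable_normc2.
by move=> t; rewrite ger0_norm ?sqr_ge0.
Qed.

Lemma dilate_analytic (c : nat -> R[i]) F (r : R) : disc_series c F -> 0 < r < 1 ->
  analytic (fun t => F (r%:C * eit t)).
Proof.
move=> hF r01; have [K [q [q01 K0 h]]] := disc_series_bound hF r01.
have mF : cmeas (fun t => F (r%:C * eit t)).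
  apply: (cmeas_limit q01 _ h) => n.
  by under eq_fun do rewrite dilate_poly; apply: L2_cmeas; exact: L2_poly.
have F2 : L2 (fun t => F (r%:C * eit t)).
  apply: Linfty_L2; apply/LinftyP; split=> //; exists K; apply: aeW => t.
  by have := h 0%N t; rewrite big_ord0 subr0 expr0 mulr1.
apply: analytic_limit => // e e0.
apply: contrapT => /forall2NP hn.
suff : e <= 0 by rewrite leNgt e0.
have /andP[q0 q1] := q01.
apply: (@le0_geometric _ e (K ^+ 2) (q ^+ 2)).
  by rewrite exprn_ge0//= exprn_ilt1.
move=> n; rewrite leNgt; apply/negP => lte.
have [/(_ (analytic_poly _))//|] := hn (fun t => (\poly_(k < n) (c k * r%:C ^+ k)).[eit t]).
apply; apply: le_lt_trans lte.
rewrite exprAC -exprMn; apply: sqnorm_le_unif.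
  by apply: L2_cmeas; apply: L2B => //; exact: L2_poly.
by move=> t; rewrite -dilate_poly.
Qed.

(** Dilates are analytic and analyticity is closed in L2. Stated for any convergent power series, it
    serves [H2plus] and [Hinfty] alike. *)
Lemma boundary_analytic c F f : L2 f -> disc_series c F -> boundary F f -> analytic f.
Proof.
move=> f2 hF bF; apply: analytic_limit => // e e0.
have se0 : 0 < Num.sqrt e by rewrite sqrtr_gt0.
pose G r := L2dist (fun t => F (r%:C * eit t)) f.
have h1 : \forall r \near (1 : R)^'-, (G r < (Num.sqrt e)%:E)%E.
  apply: (bF [set x | (x < (Num.sqrt e)%:E)%E]).
  by apply: open_ereal_lt'; rewrite lte_fin.
have h2 : \forall r \near (1 : R)^'-, 0 < r < 1.
  near=> r; apply/andP; split; near: r.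
    by apply: nbhs_left_gt.
  by apply: nbhs_left_lt.
have [r [lt_e r01]] := filter_ex (filterI h1 h2).
have Fa := dilate_analytic hF r01; have [F2 _] := Fa.
exists (fun t => F (r%:C * eit t)) => //.
move: lt_e; rewrite /G L2dist_lt// sqr_sqrtr ?ltW// -sqnormN.
by under eq_fun do rewrite opprB.
Unshelve. all: by end_near. Qed.

End PowerSeries.

(** * Fourier polynomials, Bessel's inequality and the description of H^2 *)

Section HardySpace.
Context {R : realType}.
Local Notation fct := (R -> R[i]).
Local Notation Re := (@complex.Re R).
Local Notation Im := (@complex.Im R).
Implicit Types f g : fct.

Definition fcoef f n : R[i] := cint (fun t => f t * conjc (eit t ^+ n)).

Definition fpoly f n : {poly R[i]} := \poly_(k < n) fcoef f k.

Lemma L2_conj_eitX f n : L2 f -> L2 (fun t => f t * conjc (eit t ^+ n)).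
Proof.
move=> f2; under eq_fun do rewrite mulrC; apply: LinftyM => //; apply: Linfty_conj.
exact: Linfty_eitX.
Qed.

Lemma horner_polyS (c : nat -> R[i]) n x :
  (\poly_(k < n.+1) c k).[x] = (\poly_(k < n) c k).[x] + c n * x ^+ n.
Proof. by rewrite !horner_poly big_ord_recr. Qed.

Lemma cint_conj_poly f (c : nat -> R[i]) n : L2 f ->
  cint (fun t => f t * conjc ((\poly_(k < n) c k).[eit t])) =
  \sum_(k < n) conjc (c k) * fcoef f k.
Proof.
move=> f2; elim: n => [|n ih].
  rewrite big_ord0; under eq_fun do rewrite horner_poly big_ord0 conjc0 mulr0.
  exact: cint0.
rewrite big_ord_recr/= -ih -cintZ; last first.
  by apply: L2_cintegrable1; exact: L2_conj_eitX.
rewrite -cintD.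
- congr cint; apply/funext => t.
  by rewrite horner_polyS rmorphD rmorphM mulrDr; congr (_ + _); rewrite mulrCA.
- by apply: L2_cintegrable => //; apply: L2_conj; exact: L2_poly.
- by apply: cintegrableZ; apply: L2_cintegrable1; exact: L2_conj_eitX.
Qed.

Lemma fcoefD f g n : L2 f -> L2 g -> fcoef (fun t => f t + g t) n = fcoef f n + fcoef g n.
Proof.
move=> f2 g2; rewrite /fcoef; under eq_fun do rewrite mulrDl.
by rewrite cintD//; apply: L2_cintegrable1; exact: L2_conj_eitX.
Qed.

Lemma fcoefZ c f n : L2 f -> fcoef (fun t => c * f t) n = c * fcoef f n.
Proof.
move=> f2; rewrite /fcoef; under eq_fun do rewrite -mulrA.
by rewrite cintZ//; apply: L2_cintegrable1; exact: L2_conj_eitX.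
Qed.

Lemma eitXK (t : R) n : eit t ^+ n * conjc (eit t ^+ n) = 1.
Proof. by rewrite mulc_conj normcX normc_eit !expr1n. Qed.

Lemma fcoef_eitX n k : fcoef (fun t : R => eit t ^+ n) k = (n == k)%:R.
Proof.
rewrite /fcoef; have [->|nk] := eqVneq n k.
  by under eq_fun do rewrite eitXK; exact: cint_cst.
have [kn|] := ltnP k n.
  have -> : n = (k + (n - k).-1.+1)%N by rewrite prednK ?subn_gt0// subnKC// ltnW.
  under eq_fun do rewrite exprD mulrAC eitXK mul1r.
  exact: cint_eitX.
rewrite leq_eqVlt (negbTE nk)/= => kn.
have -> : k = (n + (k - n).-1.+1)%N by rewrite prednK ?subn_gt0// subnKC// ltnW.
have e (t : R) : eit t ^+ n * conjc (eit t ^+ (n + (k - n).-1.+1)) =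
    conjc (eit t ^+ (k - n).-1.+1).
  by rewrite exprD rmorphM mulrA eitXK mul1r.
under eq_fun do rewrite e.
rewrite cint_conj ?cint_eitX ?conjc0//.
by apply: L2_cintegrable1; apply: Linfty_L2; exact: Linfty_eitX.
Qed.

Lemma fcoef_poly (c : nat -> R[i]) n k :
  fcoef (fun t => (\poly_(j < n) c j).[eit t]) k = (k < n)%N%:R * c k.
Proof.
elim: n => [|n ih].
  rewrite mul0r /fcoef; under eq_fun do rewrite horner_poly big_ord0 mul0r.
  exact: cint0.
have z2 : L2 (fun t : R => eit t ^+ n) by apply: Linfty_L2; exact: Linfty_eitX.
under eq_fun do rewrite horner_polyS.
rewrite fcoefD; [|exact: L2_poly|exact: L2Z].
rewrite fcoefZ// ih fcoef_eitX [in RHS]ltnS [in RHS]leq_eqVlt [n == k]eq_sym.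
have [->|_] /= := eqVneq k n; first by rewrite ltnn mul0r add0r mulr1 mul1r.
by rewrite mulr0 addr0.
Qed.

Lemma sqnorm_poly (c : nat -> R[i]) n :
  sqnorm (fun t => (\poly_(k < n) c k).[eit t]) = \sum_(k < n) normc (c k) ^+ 2.
Proof.
have := cint_sqnorm (L2_poly (\poly_(k < n) c k)).
rewrite cint_conj_poly; last exact: L2_poly.
move=> /(congr1 Re) /= <-; rewrite (big_morph Re (@cReD R) (erefl (Re 0))).
apply: eq_bigr => k _; rewrite fcoef_poly ltn_ord mul1r normc2E !ReImE; ring.
Qed.

Lemma sqnorm_sub_fpoly f n : L2 f ->
  sqnorm (fun t => f t - (fpoly f n).[eit t]) = sqnorm f - \sum_(k < n) normc (fcoef f k) ^+ 2.
Proof.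
move=> f2; have p2 := L2_poly (fpoly f n).
rewrite sqnormD//; last exact: L2N.
rewrite sqnormN sqnorm_poly.
have -> : (fun t => f t * conjc (- (fpoly f n).[eit t])) =
    (fun t => - (f t * conjc ((fpoly f n).[eit t]))).
  by apply/funext => t; rewrite rmorphN mulrN.
rewrite cintN; last by apply: L2_cintegrable => //; exact: L2_conj.
rewrite cint_conj_poly// cReN (big_morph Re (@cReD R) (erefl (Re 0))).
have -> : \sum_(i < n) Re (conjc (fcoef f i) * fcoef f i) =
    \sum_(i < n) normc (fcoef f i) ^+ 2.
  by apply: eq_bigr => k _; rewrite normc2E !ReImE; ring.
ring.
Qed.

Lemma bessel f n : L2 f -> \sum_(k < n) normc (fcoef f k) ^+ 2 <= sqnorm f.
Proof. by move=> f2; rewrite -subr_ge0 -sqnorm_sub_fpoly// sqnorm_ge0. Qed.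

(** f minus its Fourier polynomial is orthogonal to the polynomials of degree below n, so any other
    choice adds a nonnegative square. *)
Lemma sqnorm_sub_fpoly_best f (c : nat -> R[i]) n : L2 f ->
  sqnorm (fun t => f t - (fpoly f n).[eit t]) <=
  sqnorm (fun t => f t - (\poly_(k < n) c k).[eit t]).
Proof.
move=> f2; have p2 := L2_poly (fpoly f n).
have d2 : L2 (fun t => f t - (fpoly f n).[eit t]) by exact: L2B.
pose q : {poly R[i]} := \poly_(k < n) (fcoef f k - c k).
have -> : (fun t => f t - (\poly_(k < n) c k).[eit t]) =
   (fun t => (f t - (fpoly f n).[eit t]) + q.[eit t]).
  apply/funext => t; rewrite -addrA; congr (_ + _); rewrite /q /fpoly !horner_poly.
  rewrite -!sumrN -big_split/=; apply: eq_bigr => k _; ring.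
rewrite [leRHS]sqnormD//; last exact: L2_poly.
rewrite cint_conj_poly// big1 ?mulr0 ?addr0 ?lerDl ?sqnorm_ge0//.
move=> k _; rewrite fcoefD//; last exact: L2N.
have -> : (fun t => - (fpoly f n).[eit t]) = (fun t => (-1) * (fpoly f n).[eit t]).
  by apply/funext => t; rewrite mulN1r.
by rewrite fcoefZ// fcoef_poly ltn_ord mul1r mulN1r subrr mulr0.
Qed.

Lemma fpoly_dense f (e : R) : analytic f -> 0 < e ->
  exists M, sqnorm (fun t => f t - (fpoly f M).[eit t]) < e.
Proof.
move=> fa /(analytic_poly_dense fa)[p hp]; exists (size p).
apply: le_lt_trans hp; have := @sqnorm_sub_fpoly_best f (fun k => p`_k) (size p) fa.1.
by rewrite /= coefK.
Qed.

Lemma normc_fcoef f n : L2 f -> normc (fcoef f n) ^+ 2 <= sqnorm f.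
Proof.
move=> f2; apply: le_trans (bessel n.+1 f2); rewrite big_ord_recr/= lerDr.
by apply: sumr_ge0 => k _; exact: sqr_ge0.
Qed.

Lemma disc_series_exists (c : nat -> R[i]) (M : R) : (forall n, normc (c n) <= M) ->
  exists F, disc_series c F.
Proof.
move=> cM.
pose S (P : R[i] -> R) w n := \sum_(k < n) P (c k * w ^+ k).
exists (fun w => limn (S Re w) +i* limn (S Im w)) => w w1.
have cS (P : R[i] -> R) : (forall x, `|P x| <= normc x) -> cvgn (S P w).
  move=> PN.
  have -> : S P w = series (fun k => P (c k * w ^+ k)).
    by apply/funext => n; rewrite /series/= big_mkord.
  apply: normed_cvg; apply: (@series_le_cvg _ _ (geometric M (normc w))).
  - by move=> n /=.
  - move=> n; rewrite /geometric/= mulr_ge0 ?exprn_ge0 ?normc_ge0//.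
    by rewrite (le_trans _ (cM 0%N)) ?normc_ge0.
  - move=> n; rewrite (le_trans (PN _))// normcM normcX /geometric/=.
    by rewrite ler_wpM2r// exprn_ge0// normc_ge0.
  - by apply: is_cvg_geometric_series; rewrite ger0_norm ?normc_ge0.
have SRe n : Re (\sum_(k < n) c k * w ^+ k) = S Re w n.
  by rewrite (big_morph Re (@cReD R) (erefl (Re 0))).
have SIm n : Im (\sum_(k < n) c k * w ^+ k) = S Im w n.
  by rewrite (big_morph Im (@cImD R) (erefl (Im 0))).
apply: (@squeeze_cvgr _ _ _ _ (fun=> 0)
  (fun n => `|limn (S Re w) - S Re w n| + `|limn (S Im w) - S Im w n|)).
- apply: nearW => n; rewrite normc_ge0/=.
  by apply: le_trans (normc_le_ReIm _) _; rewrite !ReImE SRe SIm.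
- exact: cvg_cst.
- have z (u : nat -> R) : cvgn u -> `|limn u - u n| @[n --> \oo] --> (0 : R).
    move=> cu; rewrite -(normr0 R); apply: cvg_norm.
    by rewrite -[X in _ --> X](subrr (limn u)); apply: cvgB => //; exact: cvg_cst.
  rewrite -[X in _ --> X](addr0 (0 : R)); apply: cvgD; apply: z; apply: cS => x.
    exact: normc_Re.
  exact: normc_Im.
Qed.

(** Dilation multiplies the coefficient of index k by r^k. Below M the relative change is at most 1
    - r^M; from M on everything is controlled by the tail of f. *)
Lemma sqnorm_dilate f F (r : R) M : analytic f -> disc_series (fcoef f) F -> 0 < r < 1 ->
  sqnorm (fun t => F (r%:C * eit t) - f t) <=
  4 * (1 - r ^+ M) ^+ 2 * sqnorm f + 8 * sqnorm (fun t => f t - (fpoly f M).[eit t]).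
Proof.
move=> fa hF r01; have [f2 _] := fa; have /andP[r0 r1] := r01.
have [F2 _] := dilate_analytic hF r01.
have [K [q [q01 K0 hK]]] := disc_series_bound hF r01.
have /andP[q0 q1] := q01.
set D := sqnorm (fun t => f t - (fpoly f M).[eit t]).
(* The error of truncating the power series at n = M + j disappears as j grows, with M fixed. *)
rewrite -subr_le0; apply: (@le0_geometric _ _ (2 * K ^+ 2 * (q ^+ 2) ^+ M) (q ^+ 2)).
  by rewrite exprn_ge0//= exprn_ilt1.
move=> j; rewrite -[leRHS]mulrA -exprD; set n := (M + j)%N.
pose S : {poly R[i]} := \poly_(k < n) (fcoef f k * r%:C ^+ k).
have p2 := L2_poly (fpoly f n); have S2 := L2_poly S.
have -> : (fun t => F (r%:C * eit t) - f t) =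
  (fun t => (F (r%:C * eit t) - S.[eit t]) +
    ((S.[eit t] - (fpoly f n).[eit t]) + ((fpoly f n).[eit t] - f t))).
  by apply/funext => t; ring.
have h1 : sqnorm (fun t => F (r%:C * eit t) - S.[eit t]) <= K ^+ 2 * (q ^+ 2) ^+ n.
  rewrite exprAC -exprMn; apply: sqnorm_le_unif; first by apply: L2_cmeas; exact: L2B.
  by move=> t; rewrite -dilate_poly.
have h2 : sqnorm (fun t => (fpoly f n).[eit t] - f t) <= D.
  rewrite -sqnormN; under eq_fun do rewrite opprB.
  rewrite /D !sqnorm_sub_fpoly// lerD2l lerN2 /n big_split_ord/= lerDl.
  by apply: sumr_ge0 => k _; exact: sqr_ge0.
have h3 : sqnorm (fun t => S.[eit t] - (fpoly f n).[eit t]) <= (1 - r ^+ M) ^+ 2 * sqnorm f + D.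
  have -> : (fun t => S.[eit t] - (fpoly f n).[eit t]) =
      (fun t => (\poly_(k < n) (fcoef f k * (r%:C ^+ k - 1))).[eit t]).
    apply/funext => t; rewrite /S /fpoly !horner_poly -sumrN -big_split/=.
    by apply: eq_bigr => k _; ring.
  rewrite sqnorm_poly.
  have nr k : normc (r%:C ^+ k - 1) ^+ 2 = (1 - r ^+ k) ^+ 2.
    have -> : r%:C ^+ k - 1 = (r ^+ k - 1)%:C by rewrite rmorphB rmorphXn rmorph1.
    by rewrite normc_real real_normK ?num_real// -sqrrN opprB.
  under eq_bigr do rewrite normcM exprMn nr.
  have rk k : 0 <= 1 - r ^+ k <= 1.
    apply/andP; split; first by rewrite subr_ge0; apply: exprn_ile1; exact: ltW.
    by rewrite gerBl exprn_ge0// ltW.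
  rewrite /n big_split_ord/=; apply: lerD.
    apply: (@le_trans _ _ (\sum_(k < M) normc (fcoef f k) ^+ 2 * (1 - r ^+ M) ^+ 2)).
      apply: ler_sum => k _; rewrite ler_wpM2l ?sqr_ge0//.
      have /andP[a0 _] := rk k; have /andP[b0 _] := rk M.
      rewrite ler_sqr// lerD2l lerN2; apply: ler_wiXn2l; [exact: ltW..|].
      by apply: ltnW.
    by rewrite -mulr_suml mulrC ler_wpM2l ?sqr_ge0// bessel.
  apply: (@le_trans _ _ (\sum_(k < j) normc (fcoef f (M + k)%N) ^+ 2)).
    apply: ler_sum => k _; rewrite ler_piMr ?sqr_ge0//.
    by have /andP[a0 a1] := rk (M + k)%N; rewrite exprn_ile1.
  rewrite /D sqnorm_sub_fpoly// lerBrDr addrC.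
  by have := bessel n f2; rewrite /n big_split_ord.
have A2 : L2 (fun t => F (r%:C * eit t) - S.[eit t]) by exact: L2B.
have B2 : L2 (fun t => S.[eit t] - (fpoly f n).[eit t]) by exact: L2B.
have C2 : L2 (fun t => (fpoly f n).[eit t] - f t) by exact: L2B.
(* The total is at most 2x + 4y + 4z. Both y and z contain the tail of f once, whence the constants
   4 and 8. *)
have := sqnormD_le A2 (L2D B2 C2); have := sqnormD_le B2 C2.
move: h1 h2 h3; set x := sqnorm (fun t => F _ - S.[_]).
set y := sqnorm (fun t => S.[_] - _); set z := sqnorm (fun t => _ - f t).
rewrite -(mulrA 4) -(mulrA 2 (K ^+ 2)).
set X := K ^+ 2 * _; set Y := (1 - _) ^+ 2 * _. lra.
Qed.

Lemma analytic_boundary f F : analytic f -> disc_series (fcoef f) F -> boundary F f.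
Proof.
move=> fa hF; have [f2 _] := fa.
pose h r := Num.sqrt (sqnorm (fun t => F (r%:C * eit t) - f t)).
have h0 : h r @[r --> (1 : R)^'-] --> (0 : R).
  apply/cvgrPdist_lt => e e0.
  have Nf0 := sqnorm_ge0 f.
  (* M is chosen before r: the tail costs 8 * e^2/16 = e^2/2, and r near 1 brings the low
     frequencies below the other e^2/2. *)
  have e8 : 0 < e ^+ 2 / 16 by rewrite divr_gt0// exprn_gt0.
  have [M hM] := fpoly_dense fa e8.
  have cM : 4 * (1 - r ^+ M) ^+ 2 * sqnorm f @[r --> (1 : R)^'-] --> (0 : R).
    have -> : (0 : R) = 4 * (1 - 1 ^+ M) ^+ 2 * sqnorm f.
      by rewrite expr1n subrr expr0n/= mulr0 mul0r.
    apply: cvg_at_left_filter; apply: cvgM; last exact: cvg_cst.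
    apply: cvgM; first exact: cvg_cst.
    under eq_cvg do rewrite expr2; rewrite expr2.
    by apply: cvgM; apply: cvgB; first [exact: cvg_cst|exact: exprn_continuous].
  have e2 : 0 < e ^+ 2 / 2 by rewrite divr_gt0// exprn_gt0.
  near=> r.
  have r01 : 0 < r < 1.
    by apply/andP; split; near: r; [exact: nbhs_left_gt|exact: nbhs_left_lt].
  rewrite sub0r normrN ger0_norm ?sqrtr_ge0// /h.
  rewrite -ltr_sqr ?nnegrE ?sqrtr_ge0 ?ltW// sqr_sqrtr ?sqnorm_ge0//.
  apply: le_lt_trans (sqnorm_dilate M fa hF r01) _.
  have : 4 * (1 - r ^+ M) ^+ 2 * sqnorm f < e ^+ 2 / 2.
    by near: r; exact: cvgr_lt cM _ e2.
  by move: hM; lra.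
have h0' : (h r)%:E @[r --> (1 : R)^'-] --> 0%E.
  by apply: cvg_EFin => //; exact: nearW.
apply: cvg_trans h0'; apply: near_eq_cvg; near=> r.
have r01 : 0 < r < 1.
  by apply/andP; split; near: r; [exact: nbhs_left_gt|exact: nbhs_left_lt].
by rewrite /= L2distE//; have [] := dilate_analytic hF r01.
Unshelve. all: by end_near. Qed.

(** Conversely to [boundary_analytic], the Fourier coefficients are bounded by Bessel's inequality,
    so they define a function on the disc, and its dilates tend to f. *)
Lemma H2plusP f : H2plus f <-> analytic f.
Proof.
split=> [[f2 [F [c [hF _]] bF]]|fa]; first exact: boundary_analytic hF bF.
have [f2 _] := fa; split=> //.
have cM n : normc (fcoef f n) <= Num.sqrt (sqnorm f).
  rewrite -ler_sqr ?nnegrE ?normc_ge0 ?sqrtr_ge0// [leRHS]sqr_sqrtr ?sqnorm_ge0//.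
  exact: normc_fcoef.
have [F hF] := disc_series_exists cM.
exists F; last exact: analytic_boundary.
exists (fcoef f); split=> //; apply: nondecreasing_is_cvgn.
  by apply: nondecreasing_series => n _ _; exact: sqr_ge0.
exists (sqnorm f) => _ [n _ <-]; rewrite /series/= big_mkord; exact: bessel.
Qed.

Lemma H2minusP f : H2minus f <-> coanalytic f.
Proof.
split=> [[f2 h]|fc]; split=> //; last 2 first.
- by case: fc.
- by move=> g /H2plusP ga; exact: inner_coanalytic.
by move=> n; apply: (h (fun t => eit t ^+ n)); apply/H2plusP; exact: analytic_eit.
Qed.

Lemma HinftyP f : Hinfty f -> Linfty f /\ analytic f.
Proof.
move=> [fy [F [[c hF] _] bF]]; split=> //.
by apply: boundary_analytic hF bF; exact: Linfty_L2.
Qed.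

End HardySpace.

(** * Kernels of paired operators *)

Section PairedKernels.
Context {R : realType}.
Local Notation m := (circle R).
Local Notation fct := (R -> R[i]).
Implicit Types a b f g : fct.

Lemma coanalyticB f g : coanalytic f -> coanalytic g -> coanalytic (fun t => f t - g t).
Proof.
move=> [f2 f0] [g2 g0]; split; first exact: L2B.
move=> n; have := fcoefD n f2 (L2N g2); rewrite /fcoef => ->; rewrite f0 add0r.
under eq_fun do rewrite mulNr.
by rewrite cintN ?g0 ?oppr0//; apply: L2_cintegrable1; exact: L2_conj_eitX.
Qed.

Lemma coanalytic_cst0 : coanalytic (fun=> 0 : R[i]).
Proof.
split=> [|n]; first exact: L2_cst.
by under eq_fun do rewrite mul0r; exact: cint0.
Qed.

Lemma coanalyticN f : coanalytic f -> coanalytic (fun t => - f t).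
Proof.
move=> fc; rewrite (_ : (fun t => _) = fun t => 0 - f t).
  by apply: coanalyticB => //; exact: coanalytic_cst0.
by apply/funext => t; rewrite sub0r.
Qed.

(** The default value of [xget] is [cst 0], itself in V, so membership holds whether or not a
    projection exists. *)
Lemma proj_mem (V : set fct) f : V (cst 0) -> V (Defs.proj V f).
Proof. by move=> V0; rewrite /Defs.proj; case: xgetP => // g _ []. Qed.

Lemma projP (V : set fct) f g : V g -> (forall h, V h -> inner (f \- g) h = 0) ->
  forall h, V h -> inner (f \- Defs.proj V f) h = 0.
Proof.
move=> Vg fg; rewrite /Defs.proj; case: xgetP => [k _ [] //|none].
by have := none g; case.
Qed.

(** The chosen value k and g both leave a remainder orthogonal to V, so k - g, which is in V, is
    orthogonal to itself. *)
Lemma proj_ae (V : set fct) f g : L2 f -> (forall h, V h -> L2 h) -> V (cst 0) ->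
  (forall u v, V u -> V v -> V (fun t => u t - v t)) ->
  V g -> (forall h, V h -> inner (f \- g) h = 0) -> {ae m, forall t, Defs.proj V f t = g t}.
Proof.
move=> f2 V2 V0 VB Vg fg; set k := Defs.proj V f.
have Vk : V k by exact: proj_mem.
have [k2 g2] := (V2 _ Vk, V2 _ Vg).
have kg2 : L2 (fun t => k t - g t) by exact: L2B.
have : sqnorm (fun t => k t - g t) = 0.
  have := cint_sqnorm kg2.
  have -> : (fun t => (k t - g t) * conjc (k t - g t)) =
    (fun t => (f t - g t) * conjc (k t - g t) + - ((f t - k t) * conjc (k t - g t))).
    by apply/funext => t; ring.
  have fgi : cintegrable (fun t => (f t - g t) * conjc (k t - g t)).
    by apply: L2_cintegrable; [exact: L2B|exact: L2_conj].
  have fki : cintegrable (fun t => (f t - k t) * conjc (k t - g t)).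
    by apply: L2_cintegrable; [exact: L2B|exact: L2_conj].
  rewrite cintD//; last exact: cintegrable_opp.
  rewrite cintN//; have Vkg := VB _ _ Vk Vg.
  have := fg _ Vkg; rewrite /inner -/(cint _) => ->.
  have := projP Vg fg Vkg; rewrite /inner -/(cint _) => ->.
  by rewrite subr0 => -[].
by move=> /(sqnorm_eq0 kg2); apply: aeS => t /eqP; rewrite subr_eq0 => /eqP.
Qed.

Lemma Pplus_ae f g : L2 f -> analytic g -> coanalytic (fun t => f t - g t) ->
  {ae m, forall t, Pplus f t = g t}.
Proof.
move=> f2 ga fgc; apply: proj_ae => //.
- by move=> h [].
- by apply/H2plusP; exact: analytic_cst.
- by move=> u v /H2plusP ua /H2plusP va; apply/H2plusP; exact: analyticB.
- exact/H2plusP.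
- by move=> h /H2plusP ha; exact: inner_coanalytic.
Qed.

Lemma Pminus_ae f g : L2 f -> coanalytic g -> analytic (fun t => f t - g t) ->
  {ae m, forall t, Pminus f t = g t}.
Proof.
move=> f2 gc fga; apply: proj_ae => //.
- by move=> h [].
- by apply/H2minusP; exact: coanalytic_cst0.
- by move=> u v /H2minusP ua /H2minusP va; apply/H2minusP; exact: coanalyticB.
- exact/H2minusP.
- move=> h /H2minusP hc; have := inner_coanalytic hc fga.
  have [h2 _] := hc; have [fg2 _] := fga.
  have -> : (fun t => h t * conjc (f t - g t)) = (fun t => conjc ((f t - g t) * conjc (h t))).
    by apply/funext => t; apply: complexP; rewrite !ReImE; ring.
  rewrite cint_conj; last by apply: L2_cintegrable => //; exact: L2_conj.
  by move=> /eqP; rewrite conjc_eq0 => /eqP.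
Qed.

Lemma kerplusP a b g : kerplus a b g <->
  analytic g /\ exists2 f, coanalytic f & {ae m, forall t, a t * g t + b t * f t = 0}.
Proof.
split=> [[g2 [f [f2 /aeqP fk] /aeqP gf]]|[ga [f fc gf]]].
  have Pp : analytic (Pplus f).
    by apply/H2plusP; apply: proj_mem; apply/H2plusP; exact: analytic_cst.
  have Pm : coanalytic (Pminus f).
    by apply/H2minusP; apply: proj_mem; apply/H2minusP; exact: coanalytic_cst0.
  split.
    by apply: analytic_ae Pp; [exact: L2_cmeas|apply: aeS gf => t ->].
  by exists (Pminus f) => //; apply: aeS2 fk gf => t /= fk ->.
have [[g2 _] [f2 _]] := (ga, fc).
(* The element of the kernel is g + f, whose projections are g and f. *)
have gf2 : L2 (fun t => g t + f t) by exact: L2D.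
have pp : {ae m, forall t, Pplus (fun t => g t + f t) t = g t}.
  apply: Pplus_ae => //; rewrite (_ : (fun t => _) = f)//.
  by apply/funext => t; ring.
have pm : {ae m, forall t, Pminus (fun t => g t + f t) t = f t}.
  apply: Pminus_ae => //; rewrite (_ : (fun t => _) = g)//.
  by apply/funext => t; ring.
split=> //; exists (fun t => g t + f t).
  split=> //; apply/aeqP; have := ae_and pp pm.
  by apply: aeS2 gf => t gf [p1 p2]; rewrite /paired /= p1 p2.
by apply/aeqP; apply: aeS pp => t ->.
Qed.

(** The partner of g in H^2_- must be -(a/b) g, and this is coanalytic exactly when P^+ ((a/b) g)
    vanishes. *)
Lemma ker_toeplitzP a b : {ae m, forall t, b t <> 0} -> Linfty (fdiv a b) ->
  kerplus a b = ker_toeplitz (fdiv a b).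
Proof.
move=> b0 aby; apply/seteqP; split=> g.
  move=> /kerplusP[ga [f fc gf]]; split; first exact/H2plusP.
  have [g2 _] := ga.
  have abg2 : L2 (fdiv a b \* g) by exact: LinftyM.
  apply/aeqP; apply: (@Pplus_ae _ (fun=> 0)) => //; first exact: analytic_cst.
  apply: coanalytic_ae (coanalyticN fc).
    by apply: L2_cmeas; apply: L2B => //; exact: L2_cst.
  apply: aeS2 b0 gf => t b0 gf; rewrite subr0 /fdiv/=.
  have /eqP b0' := b0.
  apply: (mulfI b0'); rewrite mulrN; move/eqP: gf; rewrite addr_eq0 => /eqP <-.
  by field.
move=> [/H2plusP ga /aeqP Tg]; apply/kerplusP; split=> //.
have [g2 _] := ga.
have abg2 : L2 (fdiv a b \* g) by exact: LinftyM.
have [q [qa _ fqc]] := poly_projection abg2.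
have q0 : {ae m, forall t, q t = 0}.
  by apply: aeS2 (Pplus_ae abg2 qa fqc) Tg => t <-.
exists (fun t => - (fdiv a b \* g) t).
  apply: coanalyticN; apply: coanalytic_ae fqc; first exact: L2_cmeas.
  by apply: aeS q0 => t ->; rewrite subr0.
by apply: aeS b0 => t /eqP b0; rewrite /fdiv/=; field.
Qed.

Lemma coanalytic_conjM f g : Linfty (fconj f) -> analytic (fconj f) -> coanalytic g ->
  coanalytic (fun t => f t * g t).
Proof.
move=> fy fa gc; have [g2 _] := gc.
have e : (fun t => f t * g t) = (fun t => g t * conjc (fconj f t)).
  by apply/funext => t; rewrite /fconj conjcK mulrC.
rewrite e; apply: coanalyticM => //; rewrite -e; apply: LinftyM => //.
have := Linfty_conj fy; rewrite (_ : (fun t => _) = f)//.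
by apply/funext => t; rewrite /fconj conjcK.
Qed.

Lemma L2_polyM f (p : {poly R[i]}) : L2 f -> L2 (fun t => p.[eit t] * f t).
Proof. by move=> f2; apply: LinftyM => //; exact: Linfty_poly. Qed.

Lemma outer_approx f g : outer f -> analytic g -> forall e : R, 0 < e ->
  exists p : {poly R[i]}, sqnorm (fun t => g t - p.[eit t] * f t) < e.
Proof.
move=> [[f2 _] fo] ga e e0; have se0 : 0 < Num.sqrt e by rewrite sqrtr_gt0.
have [p hp] := fo _ ((H2plusP g).2 ga) _ se0; exists p; have [g2 _] := ga.
move: hp; rewrite L2dist_lt//; last exact: L2_polyM.
by rewrite sqr_sqrtr ?ltW// -sqnormN; under eq_fun do rewrite opprB.
Qed.

Lemma outerP f : analytic f ->
  (forall g, analytic g -> forall e : R, 0 < e ->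
    exists p : {poly R[i]}, sqnorm (fun t => g t - p.[eit t] * f t) < e) -> outer f.
Proof.
move=> fa fo; split; first exact/H2plusP.
move=> g /H2plusP ga e e0; have [[f2 _] [g2 _]] := (fa, ga).
have [p hp] := fo g ga _ (exprn_gt0 2 e0); exists p.
rewrite L2dist_lt//; last exact: L2_polyM.
by rewrite -sqnormN; under eq_fun do rewrite opprB.
Qed.

(** Every product p f vanishes on the zero set of f, so 1 could not be approximated if that set had
    positive measure. This is what permits dividing by h. *)
Lemma outer_neq0 f : outer f -> {ae m, forall t, f t <> 0}.
Proof.
move=> fo; have [[f2 _] _] := fo.
pose k t : R[i] := (if normc (f t) == 0 then 1 else 0 : R)%:C.
have mk : cmeas k.
  apply: cmeas_real; apply: measurable_fun_ifT => //.
  apply: measurable_fun_eqr => //; apply: measurable_normc; exact: L2_cmeas.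
have k2 : L2 k.
  apply: Linfty_L2; apply/LinftyP; split=> //; exists 1; apply: aeW => t.
  by rewrite /k normc_real; case: ifP; rewrite ?normr1 ?normr0.
have kk : (fun t => k t * conjc (k t)) = k.
  by apply/funext => t; rewrite /k; case: ifP; rewrite conjc_real ?mul0r ?mul1r.
have Nk : cint k = (sqnorm k)%:C by rewrite -cint_sqnorm// kk.
have : sqnorm k = 0.
  apply/eqP; rewrite eq_le sqnorm_ge0 andbT leNgt; apply/negP => Nk0.
  have [p hp] := outer_approx fo (analytic_cst 1) Nk0.
  have d2 : L2 (fun t => 1 - p.[eit t] * f t) by apply: L2B; [exact: L2_cst|exact: L2_polyM].
  (* With k the indicator of the zero set, k (1 - p f) = k, so ||k||^4 <= ||k||^2 ||1 - p f||^2,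
     against the choice of p. *)
  have := cauchy_schwarz k2 d2.
  have -> : (fun t => k t * (1 - p.[eit t] * f t)) = k.
    apply/funext => t; rewrite /k; case: ifP; last by rewrite mul0r.
    by rewrite normc_eq0 => /eqP ->; rewrite mulr0 subr0 mulr1.
  rewrite Nk normc_real real_normK ?num_real// expr2 ler_pM2l//.
  by rewrite leNgt hp.
move=> /(sqnorm_eq0 k2); apply: aeS => t kt ft; move: kt.
by rewrite /k ft normc0 eqxx => -[] /eqP; rewrite oner_eq0.
Qed.

(* Polynomial multiples of conj f approximate every test function, and on them
   orthogonality to g is orthogonality of f g to polynomials. *)
Lemma outer_division f g : outer (fconj f) -> L2 g ->
  coanalytic (fun t => f t * g t) -> coanalytic g.
Proof.
move=> fo g2 fgc; split=> // n.
have za := @analytic_eit R n; have [[f2 _] _] := fo.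
apply: (cint_conj_limit0 g2 za.1) => e /(outer_approx fo za)[p hp].
exists (fun t => p.[eit t] * fconj f t); first exact: L2_polyM.
split=> //; rewrite -(inner_coanalytic fgc (analytic_poly p)); congr cint.
by apply/funext => t; rewrite /fconj; apply: complexP; rewrite !ReImE; ring.
Qed.

End PairedKernels.

(** * Inner factors and strictness *)

Section InnerFactor.
Context {R : realType}.
Local Notation m := (circle R).
Local Notation fct := (R -> R[i]).
Implicit Types a b f g : fct.

Lemma sqnorm_poly_bound (p : {poly R[i]}) :
  exists2 B : R, 0 < B & forall f, L2 f -> sqnorm (fun t => p.[eit t] * f t) <= B * sqnorm f.
Proof.
have /LinftyP[mp [M hM]] := Linfty_poly p.
(* Adding 1 makes the constant positive, so that it can be divided by in [inner_factor]. *)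
exists (M ^+ 2 + 1) => [|f f2]; first by rewrite ltr_pwDr// sqr_ge0.
have pf2 := L2_polyM p f2.
have i1 := L2_integrable_normc2 pf2; have i2 := L2_integrable_normc2 f2.
rewrite /sqnorm -RintegralZl// /Rintegral fine_le//.
- exact: integrable_fin_num i1.
- apply: integrable_fin_num => //; exact: rintegrableZ.
apply: ae_ge0_le_integral => //.
- by move=> t _; rewrite lee_fin sqr_ge0.
- by apply/measurable_EFinP; exact: rintegrable_measurable.
- by move=> t _; rewrite lee_fin mulr_ge0 ?addr_ge0 ?sqr_ge0.
- by apply/measurable_EFinP; apply: rintegrable_measurable; exact: rintegrableZ.
- apply: aeS hM => t hM _; rewrite lee_fin normcM exprMn ler_wpM2r ?sqr_ge0//.
  rewrite (@le_trans _ _ (M ^+ 2)) ?lerDl//.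
  by rewrite ler_sqr ?nnegrE ?normc_ge0// (le_trans _ hM)// normc_ge0.
Qed.

(** |f|^2 is real, so its coefficients at opposite frequencies are conjugate; once its mean is
    subtracted, all of them vanish. *)
Lemma normc2_const f : L2 f ->
  (forall n, cint (fun t => f t * conjc (f t) * eit t ^+ n.+1) = 0) ->
  {ae m, forall t, normc (f t) ^+ 2 = sqnorm f}.
Proof.
move=> f2 h; have fc2 := L2_conj f2.
have iff' : cintegrable (fun t => f t * conjc (f t)) by exact: L2_cintegrable.
have ic : cintegrable (fun=> - (sqnorm f)%:C) by apply: L2_cintegrable1; exact: L2_cst.
have iz n : cintegrable (fun t : R => eit t ^+ n).
  by apply: L2_cintegrable1; apply: Linfty_L2; exact: Linfty_eitX.
have ifz n : cintegrable (fun t => f t * conjc (f t) * eit t ^+ n).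
  exact: (cintegrable_eitz n iff').
have hn n : cint (fun t => (f t * conjc (f t) + - (sqnorm f)%:C) * eit t ^+ n.+1) = 0.
  under eq_fun do rewrite mulrDl.
  rewrite cintD//; last exact: cintegrableZ.
  by rewrite h cintZ// cint_eitX mulr0 addr0.
have : annihilated (fun t => f t * conjc (f t) + - (sqnorm f)%:C).
  split; first exact: cintegrableD.
  case=> [[|n]|n].
  - under eq_fun do rewrite expr0z mulr1.
    by rewrite cintD// cint_cst cint_sqnorm// subrr.
  - exact: hn.
  - have -> : (fun t => (f t * conjc (f t) + - (sqnorm f)%:C) * eit t ^ Negz n) =
      (fun t => conjc ((f t * conjc (f t) + - (sqnorm f)%:C) * eit t ^+ n.+1)).
      apply/funext => t; rewrite NegzE -exprnN -exprVn -conjc_eit -rmorphXn.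
      rewrite mulc_conj -rmorphN -rmorphD rmorphM/=; congr (_ * _).
      by rewrite oppr0.
    rewrite cint_conj ?hn ?conjc0//.
    have -> : (fun t => (f t * conjc (f t) + - (sqnorm f)%:C) * eit t ^+ n.+1) =
      (fun t => f t * conjc (f t) * eit t ^+ n.+1 + - (sqnorm f)%:C * eit t ^+ n.+1).
      by apply/funext => t; rewrite mulrDl.
    by apply: cintegrableD => //; exact: cintegrableZ.
move=> /annihilated_eq0; apply: aeS => t /eqP; rewrite subr_eq0 => /eqP.
by rewrite mulc_conj => -[].
Qed.

Lemma analytic_polyM f (p : {poly R[i]}) : analytic f -> analytic (fun t => p.[eit t] * f t).
Proof.
move=> fa; apply: analyticM => //; first exact: analytic_poly.
by apply: L2_polyM; case: fa.
Qed.

(** The factor z^(j+1) moves the first possibly nonzero coefficient beyond n. The power j is general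
    because the induction on p moves each 'X into it. *)
Lemma fcoef_shift_poly f (p : {poly R[i]}) n j : analytic f ->
  (forall k, (k < n)%N -> fcoef f k = 0) ->
  fcoef (fun t => p.[eit t] * (eit t ^+ j.+1 * f t)) n = 0.
Proof.
move=> fa f0; have [f2 fz] := fa.
have zf2 i : L2 (fun t => eit t ^+ i * f t) by apply: LinftyM => //; exact: Linfty_eitX.
elim/poly_ind: p j => [|p c ih] j.
  rewrite /fcoef; under eq_fun do rewrite horner0 mul0r mul0r; exact: cint0.
have -> : (fun t => (p * 'X + c%:P).[eit t] * (eit t ^+ j.+1 * f t)) =
  (fun t => p.[eit t] * (eit t ^+ j.+2 * f t) + c * (eit t ^+ j.+1 * f t)).
  by apply/funext => t; rewrite hornerMXaddC (exprS _ j.+1); ring.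
rewrite fcoefD; [|exact: L2_polyM|exact: L2Z].
rewrite ih add0r fcoefZ// /fcoef.
suff -> : cint (fun t => eit t ^+ j.+1 * f t * conjc (eit t ^+ n)) = 0 by rewrite mulr0.
have [jn|nj] := ltnP j n.
  rewrite -(f0 (n - j.+1)%N); last by rewrite ltn_subrL/= (leq_ltn_trans _ jn).
  congr cint; apply/funext => t.
  rewrite -{1}(subnKC jn) exprD rmorphM.
  by rewrite mulrACA eitXK mul1r.
rewrite -(fz (j - n)%N); congr cint; apply/funext => t.
rewrite -subSn// -{1}(subnKC (leqW nj)) exprD.
have := eitXK t n; set x := eit t ^+ n; set y := conjc x => xy.
by rewrite [x * _]mulrC -!mulrA [f t * _]mulrC !mulrA -[_ * x * y]mulrA xy mulr1 mulrC.
Qed.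

(* Beurling's wandering vector: f minus its projection to the closure of
   z C[z] f has constant modulus. *)
Lemma inner_factor f : Linfty f -> analytic f -> ~ outer f ->
  exists I g, [/\ Linfty I /\ analytic I,
    {ae m, forall t, normc (I t) = 1},
    forall c, ~ {ae m, forall t, I t = c},
    Linfty g /\ analytic g &
    {ae m, forall t, f t = I t * g t}].
Proof.
move=> fy fa nfo; have [f2 fz] := fa.
(* For f = 0 the wandering vector is zero; the factorisation z * 0 is used instead. *)
have [Nf0|Nf0] := eqVneq (sqnorm f) 0.
  exists (fun t => eit t ^+ 1), (fun=> 0); split.
  - by split; [exact: Linfty_eitX|exact: (@analytic_eit R 1)].
  - by apply: aeW => t; rewrite normcX normc_eit expr1n.
  - move=> c h; have := fcoef_eitX 1 1 (R := R); rewrite eqxx.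
    have z2 : L2 (fun t : R => eit t ^+ 1) by case: (@analytic_eit R 1).
    have -> : fcoef (fun t : R => eit t ^+ 1) 1 = fcoef (fun=> c) 1.
      apply: cint_ae.
      - by apply: L2_cmeas; exact: L2_conj_eitX.
      - by apply: L2_cmeas; apply: L2_conj_eitX; exact: L2_cst.
      - by apply: aeS h => t ->.
    rewrite /fcoef cintZ; last first.
      by apply: L2_cintegrable1; apply: L2_conj.
    rewrite cint_conj; last exact: L2_cintegrable1.
    rewrite (cint_eitX 0) conjc0 mulr0 => /esym/eqP.
    by rewrite oner_eq0.
  - by split; [exact: Linfty_cst|exact: analytic_cst].
  - by apply: aeS (sqnorm_eq0 f2 Nf0) => t ->; rewrite mulr0.
pose D := [set d : fct | exists p : {poly R[i]}, d = fun t => p.[eit t] * (eit t ^+ 1 * f t)].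
have zfa : analytic (fun t => eit t ^+ 1 * f t).
  by under eq_fun do rewrite mulrC; exact: analytic_eitX.
have [zf2 _] := zfa.
have [q [q2 qD qo]] : exists p, [/\ L2 p,
    forall e : R, 0 < e -> exists2 d, D d & sqnorm (fun t => p t - d t) < e &
    forall d, D d -> cint (fun t => (f t - p t) * conjc (d t)) = 0].
  apply: L2_projection => //.
  - by move=> _ [p ->]; exact: L2_polyM.
  - by exists 0; apply/funext => t; rewrite horner0 mul0r.
  - move=> _ _ c [p ->] [p' ->]; exists (p + c *: p'); apply/funext => t.
    by rewrite hornerD hornerZ; ring.
have qa : analytic q.
  apply: analytic_limit => // e /qD[_ [p ->] qp].
  by eexists; [exact: (analytic_polyM p zfa)|exact: qp].
pose v t := f t - q t.
have va : analytic v by exact: analyticB.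
have [v2 vz] := va.
(* If p z f approximates q, then (1 - p z) f approximates v = f - q. *)
have vD (e : R) : 0 < e -> exists p : {poly R[i]}, sqnorm (fun t => v t - p.[eit t] * f t) < e.
  move=> /qD[_ [p ->] hp]; exists (1%:P - p * 'X).
  rewrite -sqnormN; rewrite (_ : (fun t => _) = (fun t => q t - p.[eit t] * (eit t ^+ 1 * f t)))//.
  by apply/funext => t; rewrite /v hornerD hornerN hornerM hornerX hornerC expr1; ring.
have vo n : cint (fun t => v t * conjc (eit t ^+ n.+1 * f t)) = 0.
  apply: qo; exists 'X^n; apply/funext => t.
  by rewrite hornerXn mulrA -exprD addn1.
(* v z^(n+1) is a limit of polynomial multiples of z f, all of them orthogonal to v. *)
have vv n : cint (fun t => v t * conjc (v t) * eit t ^+ n.+1) = 0.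
  have zv2 : L2 (fun t => v t * eit t ^+ n.+1) by exact: L2_eitX.
  rewrite (_ : cint _ = conjc (cint (fun t => v t * conjc (v t * eit t ^+ n.+1)))); last first.
    rewrite -cint_conj; last by apply: L2_cintegrable => //; exact: L2_conj.
    by congr cint; apply/funext => t; apply: complexP; rewrite !ReImE; ring.
  rewrite (_ : cint _ = 0) ?conjc0//.
  apply: (cint_conj_limit0 v2 zv2) => e /vD[p hp].
  have d2 := L2B v2 (L2_polyM p f2).
  exists (fun t => (p * 'X^n).[eit t] * (eit t ^+ 1 * f t)); first exact: L2_polyM.
  split; first by apply: qo; exists (p * 'X^n).
  rewrite (_ : sqnorm _ = sqnorm (fun t => v t - p.[eit t] * f t))//.
  apply: eq_Rintegral => t _.
  have -> : v t * eit t ^+ n.+1 - (p * 'X^n).[eit t] * (eit t ^+ 1 * f t) =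
      (v t - p.[eit t] * f t) * eit t ^+ n.+1.
    by rewrite hornerM hornerXn exprS expr1; ring.
  by rewrite normcM normcX normc_eit expr1n mulr1.
have vc := normc2_const v2 vv.
(* Otherwise f would be in the closure of z C[z] f, and its coefficients would vanish one after
   another. *)
have Nv0 : sqnorm v != 0.
  apply/eqP => /(sqnorm_eq0 v2) v0.
  have fq n : fcoef f n = fcoef q n.
    apply: cint_ae; [by apply: L2_cmeas; exact: L2_conj_eitX..|].
    by apply: aeS v0 => t /eqP; rewrite subr_eq0 => /eqP ->.
  have f0 n : fcoef f n = 0.
    elim/ltn_ind: n => n ih; rewrite fq; apply: normc2_small_eq0 => e /qD[_ [p ->] hp].
    have pz2 := L2_polyM p zf2.
    have := normc_fcoef n (L2B q2 pz2); rewrite fcoefD//; last exact: L2N.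
    have -> : (fun t => - (p.[eit t] * (eit t ^+ 1 * f t))) =
        (fun t => (-1) * (p.[eit t] * (eit t ^+ 1 * f t))).
      by apply/funext => t; rewrite mulN1r.
    rewrite fcoefZ// fcoef_shift_poly// mulr0 addr0 => /le_trans; apply.
    exact: ltW.
  have := analytic_coanalytic_eq0 fa (conj f2 f0).
  move=> h; move/eqP: Nf0; apply.
  rewrite (sqnorm_ae (g := fun=> 0) _ _ h); last 2 first.
  - exact: L2_cmeas.
  - exact: cmeas_cst.
  by rewrite /sqnorm normc0 expr0n/= Rintegral_cst//= mul0r.
have Nvgt0 : 0 < sqnorm v by rewrite lt0r Nv0 sqnorm_ge0.
pose s := (Num.sqrt (sqnorm v))^-1.
have sgt0 : 0 < s by rewrite invr_gt0 sqrtr_gt0.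
pose I t := s%:C * v t.
have Ia : analytic I by exact: analyticZ.
have [I2 _] := Ia.
have I1 : {ae m, forall t, normc (I t) = 1}.
  apply: aeS vc => t vt; apply/eqP.
  rewrite -(@pexpr_eq1 _ _ 2) ?normc_ge0// /I normcM exprMn vt normc_real.
  by rewrite real_normK ?num_real// /s exprVn sqr_sqrtr ?sqnorm_ge0// mulVf.
have Iy : Linfty I.
  by apply/LinftyP; split; [exact: L2_cmeas|exists 1; apply: aeS I1 => t ->].
exists I, (fun t => conjc (I t) * f t).
have gy : Linfty (fun t => conjc (I t) * f t).
  by apply: Linfty_mul => //; exact: Linfty_conj.
split=> //.
(* If I were a constant c, then c, and with it every polynomial, would be a limit of polynomial
   multiples of f, making f outer. *)
- move=> c Ic; apply: nfo; apply: outerP => // g ga e e0.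
  have c1 : normc c = 1.
    by apply: ae_const; apply: aeS2 I1 Ic => t + It; rewrite It.
  have [p hp] := analytic_poly_dense ga (divr_gt0 e0 (ltr0Sn R 3)).
  have [B B0 hB] := sqnorm_poly_bound p.
  have c0 : c != 0 by rewrite -normc_eq0 c1 oner_eq0.
  (* Multiplication by p and the normalisation scale the squared error of r by at most B s^2; the
     two errors then add up to less than 2 * e/4 + 2 * e/4. *)
  have e2 : 0 < e / 4 / (B * s ^+ 2).
    by apply: divr_gt0; [rewrite divr_gt0|apply: mulr_gt0 => //; exact: exprn_gt0].
  have [r hr] := vD _ e2.
  (* g is close to p = p I / c, and I = s v is close to s r f. *)
  exists (s%:C / c *: p * r).
  have [g2 _] := ga; have p2 := L2_poly p; have rf2 := L2_polyM r f2.
  have w2 : L2 (fun t => I t / c - (s%:C / c) * (r.[eit t] * f t)).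
    apply: L2B; last exact: L2Z.
    by under eq_fun do rewrite mulrC; exact: L2Z.
  have -> : sqnorm (fun t => g t - (s%:C / c *: p * r).[eit t] * f t) =
    sqnorm (fun t => (g t - p.[eit t]) + p.[eit t] * (I t / c - (s%:C / c) * (r.[eit t] * f t))).
    apply: sqnorm_ae.
    - by apply: L2_cmeas; apply: L2B => //; exact: L2_polyM.
    - by apply: L2_cmeas; apply: L2D; [exact: L2B|exact: L2_polyM].
    - by apply: aeS Ic => t ->; rewrite hornerM hornerZ; field.
  apply: le_lt_trans (sqnormD_le (L2B g2 p2) (L2_polyM p w2)) _.
  have h1 := hB _ w2.
  have h2 : sqnorm (fun t => I t / c - (s%:C / c) * (r.[eit t] * f t)) =
      s ^+ 2 * sqnorm (fun t => v t - r.[eit t] * f t).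
    have -> : (fun t => I t / c - (s%:C / c) * (r.[eit t] * f t)) =
        (fun t => (s%:C / c) * (v t - r.[eit t] * f t)).
      by apply/funext => t; rewrite /I; ring.
    rewrite sqnormZ; last exact: L2B.
    by rewrite normcM normcV c1 invr1 mulr1 normc_real real_normK ?num_real.
  have h3 : B * sqnorm (fun t => I t / c - (s%:C / c) * (r.[eit t] * f t)) < e / 4.
    have Bs0 : 0 < B * s ^+ 2 by apply: mulr_gt0 => //; exact: exprn_gt0.
    by rewrite h2 mulrA mulrC -ltr_pdivlMr.
  move: hp h1 h3; set x := sqnorm _; set y := sqnorm _; set z := B * _; lra.
(* The negative coefficients of conj I f are, up to conjugation and the factor s, the scalar
   products of v with z^(n+1) f, which vanish by [vo]. *)
- split=> //; split=> [|n]; first exact: Linfty_L2.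
  rewrite (_ : cint _ = conjc (s%:C * cint (fun t => v t * conjc (eit t ^+ n.+1 * f t)))).
    by rewrite vo mulr0 conjc0.
  rewrite -cintZ; last first.
    apply: L2_cintegrable => //; apply: L2_conj; apply: LinftyM => //; exact: Linfty_eitX.
  rewrite -cint_conj; last first.
    apply: cintegrableZ.
    apply: L2_cintegrable => //; apply: L2_conj; apply: LinftyM => //; exact: Linfty_eitX.
  by congr cint; apply/funext => t; rewrite /I; apply: complexP; rewrite !ReImE/=; ring.
- by apply: aeS I1 => t It; rewrite mulrA mulc_conj It expr1n mul1r.
Qed.

End InnerFactor.

(** * Purity of multiplication by a nonconstant inner function *)

Section Strictness.
Context {R : realType}.
Local Notation m := (circle R).
Local Notation fct := (R -> R[i]).
Implicit Types a b f g u I : fct.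

(** ||I - I(0)||^2 = 1 - |I(0)|^2, so |I(0)| >= 1 would make I constant. *)
Lemma normc_mean_lt1 I : L2 I -> {ae m, forall t, normc (I t) = 1} ->
  (forall c, ~ {ae m, forall t, I t = c}) -> normc (fcoef I 0) < 1.
Proof.
move=> I2 I1 Inc; rewrite ltNge; apply/negP => a1.
have NI : sqnorm I = 1.
  rewrite /sqnorm (@eq_ae_Rintegral _ _ (fun=> 1)).
  - by rewrite Rintegral_cst//= probability_setT mulr1.
  - by apply: measurable_normc2; exact: L2_cmeas.
  - exact: measurable_cst.
  - by apply: aeS I1 => t ->; rewrite expr1n.
have := sqnorm_sub_fpoly 1 I2; rewrite big_ord1 NI => hN.
have N0 : sqnorm (fun t => I t - (fpoly I 1).[eit t]) = 0.
  apply/eqP; rewrite eq_le sqnorm_ge0 andbT hN subr_le0.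
  by rewrite -(expr1n _ 2) ler_sqr ?nnegrE ?normc_ge0.
apply: (Inc (fcoef I 0)).
apply: aeS (sqnorm_eq0 (L2B I2 (L2_poly _)) N0) => t /eqP; rewrite subr_eq0 => /eqP ->.
by rewrite horner_poly big_ord1 expr0 mulr1.
Qed.

(** Multiplication by z shifts the coefficients by one, so the coefficient of index -1 is the only
    new condition. *)
Lemma coanalytic_eitM f : coanalytic f -> cint (fun t => f t * eit t) = 0 ->
  coanalytic (fun t => f t * eit t).
Proof.
move=> [f2 f0] h; split; first exact: (@L2_eitX _ f 1).
case=> [|n].
  by under eq_fun do rewrite expr0 conjc1 mulr1.
rewrite -(f0 n); congr cint; apply/funext => t.
have := eitK t; rewrite exprS; set x := eit t => xx.
by rewrite rmorphM mulrA -(mulrA (f t)) xx mulr1.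
Qed.

(** I - I(0) is divisible by z. The quotient k is analytic, hence orthogonal to u, and expanding
    this scalar product gives the identity. *)
Lemma coef_conj_inner I u : Linfty I -> analytic I -> coanalytic u ->
  cint (fun t => conjc (I t) * u t * eit t) =
  conjc (fcoef I 0) * cint (fun t => u t * eit t).
Proof.
move=> Iy [I2 I0] uc; have [u2 _] := uc.
set al := fcoef I 0.
pose k (t : R) := (I t - al) * conjc (eit t).
have alE : cint I = al.
  by rewrite /al /fcoef; under [in RHS]eq_fun do rewrite expr0 conjc1 mulr1.
have Ial2 : L2 (fun t => I t - al) by apply: L2B => //; exact: L2_cst.
have k2 : L2 k by exact: (L2_conj_eitX 1 Ial2).
have ka : analytic k.
  split=> // n.
  have -> : (fun t => k t * eit t ^+ n.+1) = (fun t => I t * eit t ^+ n + - (al * eit t ^+ n)).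
    apply/funext => t; rewrite /k exprS mulrA -(mulrA _ (conjc _)) [conjc _ * _]mulrC eitK.
    by rewrite mulr1 mulrBl.
  have z2 : L2 (fun t : R => eit t ^+ n) by case: (@analytic_eit R n).
  rewrite cintD; [|by apply: L2_cintegrable1; exact: L2_eitX
    |by apply: cintegrable_opp; apply: cintegrableZ; exact: L2_cintegrable1].
  rewrite cintN; last by apply: cintegrableZ; exact: L2_cintegrable1.
  rewrite cintZ; last exact: L2_cintegrable1.
  case: n z2 => [|n] z2; last by rewrite I0 cint_eitX mulr0 subrr.
  under eq_fun do rewrite expr0 mulr1.
  under [X in _ - al * cint X]eq_fun do rewrite expr0.
  by rewrite cint_cst alE mulr1 subrr.
have uz2 : L2 (fun t => u t * eit t) by exact: (@L2_eitX _ u 1).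
have := inner_coanalytic uc ka.
have -> : (fun t => u t * conjc (k t)) =
    (fun t => conjc (I t) * u t * eit t + - (conjc al * (u t * eit t))).
  by apply/funext => t; rewrite /k; apply: complexP; rewrite !ReImE; ring.
have iz : cintegrable (fun t => conjc (I t) * u t * eit t).
  under eq_fun do rewrite -mulrA.
  by apply: L2_cintegrable1; apply: LinftyM => //; exact: Linfty_conj.
rewrite cintD//; last by apply: cintegrable_opp; apply: cintegrableZ; exact: L2_cintegrable1.
rewrite cintN; last by apply: cintegrableZ; exact: L2_cintegrable1.
by rewrite cintZ; [move/eqP; rewrite subr_eq0 => /eqP|exact: L2_cintegrable1].
Qed.

(* The first coefficients c_n of I^n f satisfy c_n = conj I(0) c_(n+1), so they
   vanish since |I(0)| < 1; hence z f satisfies the same hypothesis. *)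
Lemma inner_pure I f : Linfty I -> analytic I -> {ae m, forall t, normc (I t) = 1} ->
  (forall c, ~ {ae m, forall t, I t = c}) ->
  (forall n, coanalytic (fun t => I t ^+ n * f t)) -> {ae m, forall t, f t = 0}.
Proof.
move=> Iy Ia I1 Inc.
have [I2 _] := Ia; have a1 := normc_mean_lt1 I2 I1 Inc.
set al := fcoef I 0 in a1.
pose Q g := forall n, coanalytic (fun t => I t ^+ n * g t).
have Qz g : Q g -> Q (fun t => g t * eit t).
  move=> Qg; have gc : coanalytic g.
    by have := Qg 0%N; under eq_fun do rewrite expr0 mul1r.
  pose c n := cint (fun t => I t ^+ n * g t * eit t).
  (* I^n g = conj I (I^(n+1) g) almost everywhere, because |I| = 1. *)
  have cS n : c n = conjc al * c n.+1.
    rewrite /c -coef_conj_inner//; apply: cint_ae.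
    - by apply: L2_cmeas; apply: (@L2_eitX _ _ 1); have [] := Qg n.
    - apply: cmeasM; last exact: cmeas_eit.
      apply: cmeasM; first by apply: cmeas_conj; exact: L2_cmeas.
      by apply: L2_cmeas; have [] := Qg n.+1.
    - apply: aeS I1 => t It; congr (_ * _); rewrite exprS.
      have := mulc_conj (I t); rewrite It expr1n => h.
      by rewrite !mulrA [conjc _ * _]mulrC h mul1r.
  (* Isometry of multiplication by I^n bounds c n independently of n. *)
  have NQ n : sqnorm (fun t => I t ^+ n * g t) = sqnorm g.
    apply: eq_ae_Rintegral.
    - by apply: measurable_normc2; apply: L2_cmeas; have [] := Qg n.
    - by apply: measurable_normc2; apply: L2_cmeas; have [] := gc.
    - by apply: aeS I1 => t It; rewrite normcM normcX It expr1n mul1r.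
  have cN n : normc (c n) ^+ 2 <= sqnorm g.
    rewrite -(NQ n); have [q2 _] := Qg n.
    have := cauchy_schwarz q2 (Linfty_L2 (Linfty_eitX 1)).
    by rewrite sqnorm_eitX mulr1.
  have ck n k : normc (c n) = normc al ^+ k * normc (c (n + k)%N).
    elim: k => [|k ih]; first by rewrite expr0 mul1r addn0.
    by rewrite ih cS normcM normc_conj exprSr addnS mulrA.
  have c0 n : c n = 0.
    suff : normc (c n) ^+ 2 <= 0.
      by rewrite exprn_even_le0//= => h; apply/eqP; rewrite -normc_eq0.
    apply: (@le0_geometric _ _ (sqnorm g) (normc al ^+ 2)).
      by rewrite exprn_ge0 ?normc_ge0//= exprn_ilt1// normc_ge0.
    move=> k; rewrite (ck n k) exprMn exprAC mulrC ler_wpM2r//.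
    by rewrite exprn_ge0// exprn_ge0// normc_ge0.
  move=> n; under eq_fun do rewrite mulrA.
  by apply: coanalytic_eitM => //; exact: c0.
move=> Qf.
have Qj j : Q (fun t => f t * eit t ^+ j).
  elim: j => [|j ih]; first by move=> n; under eq_fun do rewrite expr0 mulr1; exact: Qf.
  by under eq_fun do rewrite exprSr mulrA; exact: Qz.
have fc : coanalytic f by have := Qf 0%N; under eq_fun do rewrite expr0 mul1r.
(* [Qj] says that every z^j f is coanalytic, so the negative coefficients of f vanish as well. *)
apply: analytic_coanalytic_eq0 => //; split; first by case: fc.
move=> n; have [_ /(_ 0%N)] := Qj n.+1 0%N.
by under eq_fun do rewrite !expr0 conjc1 mulr1 mul1r.
Qed.

(** Iteration puts I^n g in the kernel, and since b is nonzero its partner must be I^n f. Then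
    [inner_pure] gives f = 0, and g = 0 because a is nonzero. *)
Lemma kerplus_inner_stable a b I : {ae m, forall t, a t <> 0} ->
  {ae m, forall t, b t <> 0} -> Linfty I -> analytic I ->
  {ae m, forall t, normc (I t) = 1} -> (forall c, ~ {ae m, forall t, I t = c}) ->
  (forall g, kerplus a b g -> kerplus a b (fun t => I t * g t)) ->
  forall g, kerplus a b g -> {ae m, forall t, g t = 0}.
Proof.
move=> a0 b0 Iy Ia I1 Inc st g kg; have /kerplusP[ga [f fc gf]] := kg.
have kn n : kerplus a b (fun t => I t ^+ n * g t).
  elim: n => [|n ih]; first by under eq_fun do rewrite expr0 mul1r.
  by under eq_fun do rewrite exprS -mulrA; exact: st.
have fn n : coanalytic (fun t => I t ^+ n * f t).
  have /kerplusP[_ [k kc hk]] := kn n; have [f2 _] := fc.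
  apply: coanalytic_ae kc.
    by apply: cmeasM; [apply: cmeasX; case: Ia => /L2_cmeas|exact: L2_cmeas].
  apply: aeS2 b0 (ae_and gf hk) => t /eqP b0 [gf' hk'].
  apply: (mulfI b0); move/eqP: hk'; rewrite addrC addr_eq0 => /eqP ->.
  move/eqP: gf'; rewrite addr_eq0 => /eqP gf'.
  by rewrite mulrCA gf' mulrN opprK mulrCA.
have f0 := inner_pure Iy Ia I1 Inc fn.
apply: aeS2 a0 (ae_and gf f0) => t /eqP a0 [gft ft].
by move: gft; rewrite ft mulr0 addr0 => /eqP; rewrite mulf_eq0 (negbTE a0) => /eqP.
Qed.

End Strictness.

(** * The inclusions, the equalities and the strictness *)

Theorem proposition3p3 (R : realType) (a b h : R -> R[i])
    (ha : Linfty a) (hb : Linfty b)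
    (a_neq0 : {ae circle R, forall t, a t <> 0})
    (b_neq0 : {ae circle R, forall t, b t <> 0})
    (hab : (a = b %[ae circle R]) \/ {ae circle R, forall t, a t - b t <> 0})
    (hh : Hinfty (fconj h)) :
  [/\ kerplus a (b \* h) `<=` kerplus a b /\
      kerplus a b `<=` kerplus (a \* h) b,
      outer (fconj h) ->
        (Linfty (fdiv a (b \* h)) -> kerplus a (b \* h) = kerplus a b) /\
        (Linfty (fdiv a b) ->
           kerplus (a \* h) b = kerplus a b /\
           kerplus a b = ker_toeplitz (fdiv a b)) &
      ~ outer (fconj h) ->
        (nontrivial (kerplus a b) ->
           kerplus a (b \* h) `<` kerplus a b) /\
        (nontrivial (kerplus (a \* h) b) ->
           kerplus a b `<` kerplus (a \* h) b)].
Proof.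
have [hy hA] := HinftyP hh.
have hM f : coanalytic f -> coanalytic (fun t => h t * f t) by exact: coanalytic_conjM.
have mh : cmeas h.
  have /LinftyP[mh _] := Linfty_conj hy.
  rewrite (_ : h = fun t => conjc (fconj h t))//.
  by apply/funext => t; rewrite /fconj conjcK.
have sub1 : kerplus a (b \* h) `<=` kerplus a b.
  move=> g /kerplusP[ga [f fc gf]]; apply/kerplusP; split=> //.
  by exists (fun t => h t * f t); [exact: hM|apply: aeS gf => t /=; rewrite mulrA].
have sub2 : kerplus a b `<=` kerplus (a \* h) b.
  move=> g /kerplusP[ga [f fc gf]]; apply/kerplusP; split=> //.
  exists (fun t => h t * f t); first exact: hM.
  apply: aeS gf => t /= gf; rewrite mulrAC mulrCA [_ * h t]mulrC -mulrDr gf.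
  by rewrite mulr0.
split=> //.
- move=> ho; split.
  + move=> hdiv; apply/seteqP; split=> // g /kerplusP[ga [f fc gf]].
    apply/kerplusP; split=> //; have [g2 _] := ga.
    (* The only possible partner of g for b h. It is in L2 as the quotient is bounded, and h times
       it is -(a/b) g = f, so [outer_division] applies. *)
    have q2 : L2 (fun t => - (fdiv a (b \* h) t * g t)) by apply: L2N; exact: LinftyM.
    have h0 : {ae circle R, forall t, h t <> 0}.
      by apply: aeS (outer_neq0 ho) => t; apply: contra_not => ht; rewrite /fconj ht conjc0.
    exists (fun t => - (fdiv a (b \* h) t * g t)).
      apply: (outer_division ho q2); apply: coanalytic_ae fc.
        by apply: cmeasM => //; exact: L2_cmeas q2.
      apply: aeS2 gf (ae_and b_neq0 h0) => t gf [/eqP b0 /eqP ht].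
      apply: (mulfI b0); move/eqP: gf; rewrite addrC addr_eq0 => /eqP ->.
      by rewrite /fdiv/=; field; rewrite b0 ht.
    apply: aeS2 b_neq0 h0 => t /eqP b0 /eqP ht.
    by rewrite /fdiv/=; field; rewrite b0 ht.
  + move=> hdiv; split; last exact: ker_toeplitzP.
    apply/seteqP; split=> // g /kerplusP[ga [f fc gf]].
    apply/kerplusP; split=> //; have [g2 _] := ga.
    (* Here a h g + b f = 0, so h times this candidate is again f. *)
    have q2 : L2 (fun t => - (fdiv a b t * g t)) by apply: L2N; exact: LinftyM.
    exists (fun t => - (fdiv a b t * g t)).
      apply: (outer_division ho q2); apply: coanalytic_ae fc.
        by apply: cmeasM => //; exact: L2_cmeas q2.
      apply: aeS2 gf b_neq0 => t gf /eqP b0.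
      apply: (mulfI b0); move/eqP: gf; rewrite addrC addr_eq0 => /eqP ->.
      by rewrite /fdiv/=; field.
    by apply: aeS b_neq0 => t /eqP b0; rewrite /fdiv/=; field.
- move=> hno; have [I [g [[Iy Ia] I1 Inc [gy gA] hI]]] := inner_factor hy hA hno.
  have stable := kerplus_inner_stable a_neq0 b_neq0 Iy Ia I1 Inc.
  have hIg : {ae circle R, forall t, I t * h t = conjc (g t)}.
    apply: aeS2 I1 hI => t It; rewrite /fconj => /(congr1 conjc); rewrite conjcK => ->.
    by rewrite rmorphM mulrA mulc_conj It expr1n mul1r.
  have gM f : coanalytic f -> coanalytic (fun t => conjc (g t) * f t).
    move=> fc; rewrite (_ : (fun t => _) = (fun t => f t * conjc (g t))); last first.
      by apply/funext => t; rewrite mulrC.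
    apply: coanalyticM => //; under eq_fun do rewrite mulrC.
    by apply: LinftyM; [exact: Linfty_conj|case: fc].
  split=> [[x Vx xn0]|[x Vx xn0]]; split=> // sub; apply: xn0; apply/aeqP.
  (* The supposed equality provides a partner of y for b h; multiplication by I turns h into conj g
     and puts I y in the kernel for (a, b). *)
  + apply: stable Vx => y /[dup] /kerplusP[ya _] /sub /kerplusP[_ [f fc yf]].
    apply/kerplusP; split.
      by apply: analyticM => //; apply: LinftyM => //; case: ya.
    exists (fun t => conjc (g t) * f t); first exact: gM.
    apply: aeS2 hIg yf => t <- /= yf.
    have -> : a t * (I t * y t) + b t * (I t * h t * f t) =
      I t * (a t * y t + b t * h t * f t) by ring.
    by rewrite yf mulr0.
  (* Multiplying a y + b f = 0 by I h = conj g puts I y in the kernel for (a h, b), from which the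
     supposed equality leads back to (a, b). *)
  + have {}stable := stable _ x (sub _ Vx); apply: stable => y /kerplusP[ya [f fc yf]].
    apply: sub; apply/kerplusP; split.
      by apply: analyticM => //; apply: LinftyM => //; case: ya.
    exists (fun t => conjc (g t) * f t); first exact: gM.
    apply: aeS2 hIg yf => t <- /= yf.
    have -> : a t * h t * (I t * y t) + b t * (I t * h t * f t) =
      I t * h t * (a t * y t + b t * f t) by ring.
    by rewrite yf mulr0.
Qed.
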